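(* Let $\Gamma$ be a circular polygon. Then there are uncountably many asymptotic generic sliding billiard trajectories that approach the boundary with uniform linear speed. That is, there are constants $0<a<b$ such that if $\{\theta_n\}_{n\in\mathbb{Z}}$ is the corresponding sequence of angles of incidence/reflection of any of these uncountably many asymptotic generic sliding billiard trajectories, then $$a|n|\le 1/\theta_n\le b|n|,\qquad\forall |n|\gg1 .$$ Linear speed is optimal. That is, there is no billiard trajectory in $\Gamma$ such that $$\lim_{n\to+\infty}n\theta_n=0 .$$
   Context: **Circular polygons.** A circular $k$-gon is a simple closed strictly convex curve $\Gamma\subset\mathbb{R}^2\simeq\mathbb{C}$ formed by the concatenation of $k>1$ circular arcs $\Gamma_1,\dots,\Gamma_k$ (listed counter-clockwise, index modulo $k$) that is $C^1$ but not $C^2$ at the intersection point (node) of any two consecutive arcs; so consecutive arcs have different radii, and circles are excluded. A circular polygon is a circular $k$-gon for some $k$. The arc $\Gamma_j$ has center $O_j$, radius $r_j>0$ and angular range $[a_j,b_j]$, with $b_j=a_{j+1}$ and $a_1<b_1=a_2<\cdots<b_k=a_1+2\pi$. The polar parametrisation is $z:\mathbb{T}=\mathbb{R}/2\pi\mathbb{Z}\to\Gamma$, $z(\varphi)=O_j+r_je^{i\varphi}$ for $\varphi\in[a_j,b_j]$. **Billiard map.** $\mathcal{M}=\mathbb{T}\times[0,\pi]$. For $0<\theta<\pi$, the line through $z(\varphi)$ in the direction $v$ obtained by rotating $z'(\varphi)$ counter-clockwise by $\theta$ meets $\Gamma$ at exactly one other point $z(\bar\varphi)$; $\bar\theta\in(0,\pi)$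 is the counter-clockwise angle from $v$ to $z'(\bar\varphi)$, and $f(\varphi,\theta)=(\bar\varphi,\bar\theta)$; $f=\mathrm{id}$ on $\partial\mathcal{M}$. A billiard trajectory is the orbit $(\varphi_n,\theta_n)=f^n(\varphi,\theta)$ of a point with $0<\theta<\pi$; $\theta_n$ is its $n$-th angle of incidence/reflection. **Generic sliding.** Let $\mathcal{L}_j=\{a_j\}\times[0,\pi]$ and, for $s>0$, $\mathcal{L}_j^s=\{(\varphi,\theta)\in\mathcal{M}:\varphi=a_j+2\theta s\le a_{j+1}\}$. The extended singularity set is $\mathcal{L}=\bigcup_{j=1}^k(\mathcal{L}_j\cup\mathcal{L}_j^{1/2}\cup\mathcal{L}_j^1)$. For $x=(\varphi,\theta)\in\mathcal{M}\setminus\mathcal{L}$ let $J(x)\in\mathbb{Z}/k\mathbb{Z}$ be the index with $a_{J(x)}<\varphi<b_{J(x)}$. The trajectory of $x$ is generic (counter-clockwise) sliding if $f^n(x)\notin\mathcal{L}$ and $J(f^{n+1}(x))-J(f^n(x))\in\{0,1\}$ for all $n\in\mathbb{Z}$. It is asymptotic if $\theta_n\to0$ as $n\to\pm\infty$. ''Uniform'' means that $a,b$ do not depend on the trajectory (while the threshold in $|n|\gg1$ may). *)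

(* Defs.v *)
From HB Require Import structures.
From mathcomp Require Export all_boot all_order all_algebra.
From mathcomp Require Export complex.
From mathcomp Require Export all_classical all_reals all_analysis.

Set Implicit Arguments.
Unset Strict Implicit.
Unset Printing Implicit Defensive.

Import Order.TTheory GRing.Theory Num.Theory numFieldNormedType.Exports.

Local Open Scope classical_set_scope.
Local Open Scope ring_scope.
Local Open Scope complex_scope.

(* The plane is R[i].  T = R/2piZ is represented by the fundamental domain
   [a_0, a_0 + 2pi[, where a_0 is the first node angle; two reals are equal in
   T iff they have the same image under expi. *)

Section RawCurve.
Variable R : realType.

Definition expi (t : R) : R[i] := cos t +i* sin t.

Definition arc_point (c : R[i]) (r t : R) : R[i] := c + r%:C * expi t.

(* First and second derivatives with respect to arc length, at arc_point c r t,
   of the counter-clockwise circle of center c and radius r.  The imaginary unit is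
   spelled out because 'i parses here as Num.imaginary. *)
Definition arc_tangent (t : R) : R[i] := (0 +i* 1) * expi t.
Definition arc_curvature (r t : R) : R[i] := - ((r^-1)%:C * expi t).

(* Arcs are numbered from 0: arc j has center c j, radius r j and angular range
   [a j, a j.+1]; only a 0, ..., a k are relevant.  The half-open test matters
   only for choosing one of the two arcs at a node, where both give the same
   point; the value 0 is never reached on [a 0, a k[. *)
Definition polar (k : nat) (c : 'I_k -> R[i]) (r : 'I_k -> R) (a : nat -> R)
    (t : R) : R[i] :=
  if [pick j : 'I_k | a j <= t < a j.+1] is Some j
  then arc_point (c j) (r j) t else 0.

End RawCurve.

(* A unit-speed concatenation of arcs is C^n at a node iff the one-sided
   arc-length derivatives of order at most n agree there.  ordS is the
   successor modulo k. *)
Record circular_polygon (R : realType) := CircularPolygon {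
  narcs : nat;
  center : 'I_narcs -> R[i];
  radius : 'I_narcs -> R;
  angle : nat -> R;
  narcs_gt1 : (1 < narcs)%N;
  radius_gt0 : forall j, 0 < radius j;
  angle_lt : forall j : 'I_narcs, angle j < angle j.+1;
  angle_full : angle narcs = angle 0 + 2 * pi;
  node_C0 : forall j : 'I_narcs,
    arc_point (center j) (radius j) (angle j.+1) =
    arc_point (center (ordS j)) (radius (ordS j)) (angle (ordS j));
  node_C1 : forall j : 'I_narcs,
    arc_tangent (angle j.+1) = arc_tangent (angle (ordS j));
  node_notC2 : forall j : 'I_narcs,
    arc_curvature (radius j) (angle j.+1) <>
    arc_curvature (radius (ordS j)) (angle (ordS j));
  curve_simple : forall s t,
    angle 0 <= s < angle 0 + 2 * pi -> angle 0 <= t < angle 0 + 2 * pi ->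
    polar center radius angle s = polar center radius angle t -> s = t;
  (* Every point of the curve other than z(s) lies strictly to the left of the
     oriented tangent line at z(s). *)
  curve_strictly_convex : forall s t,
    angle 0 <= s < angle 0 + 2 * pi -> angle 0 <= t < angle 0 + 2 * pi ->
    s <> t ->
    0 < complex.Im (conjc (arc_tangent s) *
          (polar center radius angle t - polar center radius angle s))
}.

Section Billiard.
Variables (R : realType) (G : circular_polygon R).

Local Notation k := (narcs G).
Local Notation a := (angle G).
Local Notation z := (polar (@center R G) (@radius R G) a).

Definition phase_space : set (R * R) :=
  [set x | a 0%N <= x.1 < a 0%N + 2 * pi /\ 0 <= x.2 <= pi].

Definition phase_interior : set (R * R) :=
  [set x | a 0%N <= x.1 < a 0%N + 2 * pi /\ 0 < x.2 < pi].

(* arc_tangent t is the direction of z'(t), also at nodes, where the one-sided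
   derivatives of z are two different positive multiples of it. *)
Definition reflects (x y : R * R) : Prop :=
  let v := arc_tangent x.1 * expi x.2 in
  [/\ phase_interior y,
      z y.1 <> z x.1,
      exists t : R, z y.1 = z x.1 + t%:C * v
    & arc_tangent y.1 = v * expi y.2].

Definition billiard_map (x : R * R) : R * R :=
  if `[< phase_interior x >] then xget x [set y | reflects x y] else x.

Definition billiard_inv (y : R * R) : R * R :=
  xget y [set x | phase_space x /\ billiard_map x = y].

Definition billiard_iter (n : int) (x : R * R) : R * R :=
  match n with
  | Posz m => iter m billiard_map x
  | Negz m => iter m.+1 billiard_inv x
  end.

Definition trajectory (x : R * R) : set (R * R) :=
  range (fun n : int => billiard_iter n x).

Definition singular_node (j : 'I_k) : set (R * R) :=
  [set x | phase_space x /\ expi x.1 = expi (a j)].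

Definition singular_slope (j : 'I_k) (s : R) : set (R * R) :=
  [set x | [/\ phase_space x,
               expi x.1 = expi (a j + 2 * x.2 * s)
             & a j + 2 * x.2 * s <= a j.+1]].

Definition singularity_set : set (R * R) :=
  [set x | exists j : 'I_k,
    [\/ singular_node j x, singular_slope j (1 / 2) x | singular_slope j 1 x]].

Definition arc_index (x : R * R) (j : 'I_k) : Prop := a j < x.1 < a j.+1.

Definition generic_sliding (x : R * R) : Prop :=
  forall n : int,
    ~ singularity_set (billiard_iter n x) /\
    exists j j' : 'I_k,
      [/\ arc_index (billiard_iter n x) j,
          arc_index (billiard_iter (n + 1) x) j'
        & j' = j \/ j' = ordS j].

Definition asymptotic (x : R * R) : Prop :=
  ((fun n : nat => (billiard_iter (n%:Z) x).2) @ \oo --> (0 : R)) /\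
  ((fun n : nat => (billiard_iter (- n%:Z) x).2) @ \oo --> (0 : R)).

Definition linear_speed (c d : R) (x : R * R) : Prop :=
  exists N : nat, forall n : int, (N <= `|n|)%N ->
    c * (`|n|%N)%:R <= 1 / (billiard_iter n x).2 <= d * (`|n|%N)%:R.

End Billiard.

(* Main.v *)
Require Import Defs.
From mathcomp Require Import ring lra zify.
Set Implicit Arguments.
Unset Strict Implicit.
Unset Printing Implicit Defensive.

Import Order.TTheory GRing.Theory Num.Theory numFieldNormedType.Exports.
Local Open Scope classical_set_scope.
Local Open Scope ring_scope.
Local Open Scope complex_scope.

(** The incidence angle is constant along an arc, and changes only at a chord that
    passes a node. If [d i] is the mid-angle, relative to the node, of the chord that
    starts the [i]-th visit to an arc, and the visit has [n i] impacts, then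
    [th i = (len i + d (i + 1) - d i) / (2 * n i)], so a sliding trajectory is a
    bi-infinite sequence [d] that solves one equation per node. This equation is
    monotone in [d (i - 1)] and [d (i + 1)], hence solvable between a sub- and a
    supersolution. These exist as soon as [n i] is within 1 of [len i / (2 * T i)],
    where [T i] is a small multiple of [r ^ (- 1 / 4) * (1 + e) ^ (- |i|)]. Geometric
    growth of [n i] and [1 / th i] gives linear speed, and the freedom of adding 0 or
    1 to each [n i] gives uncountably many trajectories.

    Conversely, passing a node multiplies the angle by at least a constant [g > 0].
    If [n * theta_n] is small, at most one node is passed between the times [n] and
    [K * n], so [K * n * theta_(K * n) >= g * K * (n * theta_n)], which for
    [g * K >= 1] excludes convergence to 0. *)

(** * Angles modulo [2 * pi] *)

Section Expi.
Variable R : realType.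
Implicit Types s t u : R.

Lemma expiD s t : expi (s + t) = expi s * expi t.
Proof. by rewrite /expi cosD sinD; simpc; rewrite [X in _ +i* X]addrC. Qed.

Lemma expi0 : expi (0 : R) = 1.
Proof. by rewrite /expi cos0 sin0. Qed.

Lemma expiVr t : expi t * expi (- t) = 1.
Proof. by rewrite -expiD subrr expi0. Qed.

Lemma expi_neq0 t : expi t != 0.
Proof.
by apply/eqP => e0; have := expiVr t; rewrite e0 mul0r => /esym/eqP; rewrite oner_eq0.
Qed.

Lemma cos_half t : cos t = 1 - 2 * sin (t / 2) ^+ 2.
Proof.
have {1}-> : t = (t / 2) *+ 2 by rewrite -mulr_natr; field.
by rewrite cos_mulr2n cos2sin2; ring.
Qed.

(** Otherwise [cos (t - s) = 1] makes the sine of the half-difference vanish, although the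
    half-difference lies strictly between 0 and [pi]. *)
Lemma expi_inj b s t : b <= s < b + 2 * pi -> b <= t < b + 2 * pi ->
  expi s = expi t -> s = t.
Proof.
move=> sb tb; wlog st : s t sb tb / s <= t.
  by move=> H E; case/orP: (le_total s t) => ?; [|apply/esym]; apply: H.
move=> E.
have E1 : expi (t - s) = 1 by rewrite expiD -E expiVr.
have : cos (t - s) = 1 by case: E1.
rewrite cos_half => E2.
have /eqP : sin ((t - s) / 2) ^+ 2 = 0 by lra.
rewrite sqrf_eq0 => /eqP sin_eq0.
case: (ltP s t) => [lt_st|ts]; last by apply/eqP; rewrite eq_le st ts.
have : 0 < sin ((t - s) / 2) by apply: sin_gt0_pi; lra.
by rewrite sin_eq0 ltxx.
Qed.

Lemma arc_tangent_inj s t : arc_tangent s = arc_tangent t -> expi s = expi t.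
Proof.
apply: mulfI; apply/eqP => -[] /eqP.
by rewrite oner_eq0.
Qed.

Lemma arc_tangentD s t : arc_tangent (s + t) = arc_tangent s * expi t.
Proof. by rewrite /arc_tangent expiD mulrA. Qed.

(* Arcs of the polygon and determinism of the billiard map *)
End Expi.

Section Polygon.
Variables (R : realType) (G : circular_polygon R).
Local Notation k := (narcs G).
Local Notation a := (angle G).
Local Notation z := (polar (@center R G) (@radius R G) a).

Lemma narcs_gt0 : (0 < k)%N.
Proof. exact: leq_trans (narcs_gt1 G). Qed.

Lemma angle_mono (i j : nat) : (i < j)%N -> (j <= k)%N -> a i < a j.
Proof.
elim: j => // j IH; rewrite ltnS leq_eqVlt => /orP[/eqP->|ij] jk.
  exact: (angle_lt (Ordinal jk)).
by apply: lt_trans (IH ij (ltnW jk)) (angle_lt (Ordinal jk)).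
Qed.

Lemma angle_mono_le (i j : nat) : (i <= j)%N -> (j <= k)%N -> a i <= a j.
Proof.
by rewrite leq_eqVlt => /orP[/eqP->//|ij jk]; exact/ltW/angle_mono.
Qed.

Lemma arc_domain (j : 'I_k) t : a j <= t < a j.+1 ->
  a 0%N <= t < a 0%N + 2 * pi.
Proof.
case/andP=> jt tj; rewrite (le_trans _ jt) ?angle_mono_le ?(ltnW (ltn_ord _))//=.
by rewrite (lt_le_trans tj)// -angle_full angle_mono_le.
Qed.

Lemma arc_uniq (i j : 'I_k) t :
  a i <= t < a i.+1 -> a j <= t < a j.+1 -> i = j.
Proof.
move=> /andP[it ti] /andP[jt tj]; apply/val_inj => /=.
case: (ltngtP i j) => [ij|ij|//].
- have H := angle_mono_le ij (ltnW (ltn_ord j)).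
  by move: (le_lt_trans (le_trans H jt) ti); rewrite ltxx.
- have H := angle_mono_le ij (ltnW (ltn_ord i)).
  by move: (le_lt_trans (le_trans H it) tj); rewrite ltxx.
Qed.

Lemma arc_exists t : a 0%N <= t < a 0%N + 2 * pi ->
  exists j : 'I_k, a j <= t < a j.+1.
Proof.
move=> /andP[t0 t1].
have [n [nk [n0 n1]]] : exists n, (n < k)%N /\ (a n <= t /\ t < a n.+1).
  apply: contrapT => H.
  suff : forall n, (n <= k)%N -> a n <= t.
    by move=> /(_ k (leqnn _)); rewrite angle_full; lra.
  elim=> // n IH nk; rewrite leNgt; apply/negP => tn; apply: H.
  by exists n; split => //; split => //; apply: IH; exact: ltnW.
by exists (Ordinal nk); rewrite n0 n1.
Qed.

Lemma polar_arc (j : 'I_k) t : a j <= t < a j.+1 ->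
  z t = arc_point (center j) (radius j) t.
Proof.
move=> jt; rewrite /polar; case: pickP => [i it|/(_ j)]; last by rewrite jt.
by rewrite (arc_uniq it jt).
Qed.

(** Of three distinct collinear points one lies between the other two, so its tangent line cannot
    have both of them strictly on its left. *)
Lemma chord_third_point s t u (v : R[i]) (x y : R) :
  a 0%N <= s < a 0%N + 2 * pi -> a 0%N <= t < a 0%N + 2 * pi ->
  a 0%N <= u < a 0%N + 2 * pi -> s <> t -> s <> u ->
  z t = z s + x%:C * v -> z u = z s + y%:C * v -> t = u.
Proof.
move=> sD tD uD st su zt zu; apply: contrapT => tu.
have K p q (w : R) : z q - z p = w%:C * v ->
    complex.Im (conjc (arc_tangent p) * (z q - z p)) =
    w * complex.Im (conjc (arc_tangent p) * v).
  by move=> ->; rewrite mulrCA; case: (_ * v) => ? ?; simpc.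
have H1 := curve_strictly_convex sD tD st.
have H2 := curve_strictly_convex sD uD su.
have H3 := curve_strictly_convex tD sD (nesym st).
have H4 := curve_strictly_convex tD uD tu.
have H5 := curve_strictly_convex uD sD (nesym su).
have H6 := curve_strictly_convex uD tD (nesym tu).
rewrite (K _ _ x) ?zt in H1; last by ring.
rewrite (K _ _ y) ?zu in H2; last by ring.
rewrite (K _ _ (- x)) in H3; last by rewrite zt rmorphN /=; ring.
rewrite (K _ _ (y - x)) in H4; last by rewrite zt zu rmorphB /=; ring.
rewrite (K _ _ (- y)) in H5; last by rewrite zu rmorphN /=; ring.
rewrite (K _ _ (x - y)) in H6; last by rewrite zt zu rmorphB /=; ring.
move: (complex.Im _) (complex.Im _) (complex.Im _) H1 H2 H3 H4 H5 H6 => C B A.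
move=> H1 H2 H3 H4 H5 H6.
(* The products no longer depend on the signs of [A], [B] and [C]: they say that each of the line
   parameters [0], [x], [y] has the other two on the same side. *)
have P1 : 0 < (x * A) * (y * A) by apply: mulr_gt0.
have P2 : 0 < (- x * B) * ((y - x) * B) by apply: mulr_gt0.
have P3 : 0 < (- y * C) * ((x - y) * C) by apply: mulr_gt0.
have Q1 : 0 < x * y.
  by move: P1; rewrite mulrACA pmulr_lgt0// -expr2 exprn_even_gt0//=; apply/eqP => A0;
     move: H1; rewrite A0 mulr0 ltxx.
have Q2 : 0 < x * (x - y).
  have : 0 < - x * (y - x).
    move: P2; rewrite mulrACA pmulr_lgt0// -expr2 exprn_even_gt0//=; apply/eqP => A0.
    by move: H3; rewrite A0 mulr0 ltxx.
  lra.
have Q3 : 0 < y * (y - x).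
  have : 0 < - y * (x - y).
    move: P3; rewrite mulrACA pmulr_lgt0// -expr2 exprn_even_gt0//=; apply/eqP => A0.
    by move: H5; rewrite A0 mulr0 ltxx.
  lra.
case: (ltgtP x 0) => x0; last by move: Q1; rewrite x0 mul0r ltxx.
- rewrite nmulr_rgt0 // in Q1; rewrite nmulr_rgt0 // in Q2; rewrite nmulr_rgt0 // in Q3; lra.
- rewrite pmulr_rgt0 // in Q1; rewrite pmulr_rgt0 // in Q2; rewrite pmulr_rgt0 // in Q3; lra.
Qed.

Lemma expi_inj_0pi (s t : R) : 0 < s < pi -> 0 < t < pi -> expi s = expi t -> s = t.
Proof.
by move=> s0 t0; apply: (expi_inj (b := 0)); have := pi_gt0 R; lra.
Qed.

(** Leaves a single candidate for [xget] in [billiard_map]. *)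
Lemma reflects_functional x y y' : phase_interior G x ->
  reflects G x y -> reflects G x y' -> y = y'.
Proof.
move=> [xD _] [[yD yp] yx [t zy] ty] [[yD' yp'] yx' [t' zy'] ty'].
have E : y.1 = y'.1.
  apply: (chord_third_point xD yD yD' _ _ zy zy') => E; [apply: yx|apply: yx'];
  by rewrite E.
case: y y' E ty ty' yp yp' {yD zy yx yD' zy' yx'} => y1 y2 [y1' y2'] /= -> -> + yp yp'.
move=> /mulfI H; congr pair; apply: expi_inj_0pi => //; apply: H.
rewrite mulf_neq0 ?expi_neq0 // mulf_neq0 ?expi_neq0 //.
by apply/eqP => -[] /eqP; rewrite oner_eq0.
Qed.

Lemma reflects_injective x x' y : phase_interior G x -> phase_interior G x' ->
  reflects G x y -> reflects G x' y -> x = x'.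
Proof.
move=> [xD xp] [xD' xp'] [[yD yp] yx [t zy] ty] [_ yx' [t' zy'] ty'].
set v := arc_tangent x.1 * expi x.2 in zy ty.
set v' := arc_tangent x'.1 * expi x'.2 in zy' ty'.
have vv : v = v' by apply: (mulIf (expi_neq0 y.2)); rewrite -ty -ty'.
have E : x.1 = x'.1.
  apply: (@chord_third_point y.1 _ _ v (- t) (- t')) => //.
  - by move=> E; apply: yx; rewrite E.
  - by move=> E; apply: yx'; rewrite E.
  - by rewrite zy rmorphN /=; ring.
  - by rewrite zy' -vv rmorphN /=; ring.
move: vv; rewrite /v /v'.
case: x x' E xp xp' {xD zy yx xD' zy' yx' v v' ty ty'} => x1 x2 [x1' x2'] /= -> xp xp'.
move=> /mulfI H; congr pair; apply: expi_inj_0pi => //; apply: H.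
rewrite mulf_neq0 ?expi_neq0 //.
by apply/eqP => -[] /eqP; rewrite oner_eq0.
Qed.

Lemma billiard_map_reflects x y : phase_interior G x -> reflects G x y ->
  billiard_map G x = y.
Proof.
move=> xI xy; rewrite /billiard_map; case: asboolP => // _.
by case: xgetP => [w _ xw|/(_ y)//]; exact: (reflects_functional xI xw xy).
Qed.

(** The fixed point is the default value of [xget]; admitting it here avoids proving that the chord
    meets the curve again. *)
Lemma billiard_map_spec x : phase_interior G x ->
  reflects G x (billiard_map G x) \/ billiard_map G x = x.
Proof.
move=> xI; rewrite /billiard_map; case: asboolP => // _.
by case: xgetP => [w _ xw|_]; [left|right].
Qed.

(** The reflection from [y] to [w] excludes that [y] is its own preimage by the default value of
    [xget], so that [x] is the only preimage. *)
Lemma billiard_inv_reflects x y w : phase_interior G x ->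
  reflects G x y -> reflects G y w -> billiard_inv G y = x.
Proof.
move=> xI xy yw.
have yI : phase_interior G y by case: xy.
have xP : phase_space G x.
  by case: xI => ? /andP[x0 x1]; split => //; rewrite !ltW.
have H : (phase_space G x /\ billiard_map G x = y).
  by split => //; exact: billiard_map_reflects.
rewrite /billiard_inv; case: xgetP => [x' _ [x'P x'y]|/(_ x)//].
have yy : billiard_map G y <> y.
  rewrite (billiard_map_reflects yI yw) => wy.
  by case: yw => _ + _ _; rewrite wy.
case: (pselect (phase_interior G x')) => x'I; last first.
  by move: x'y; rewrite /billiard_map; case: asboolP => // _ x'y; rewrite x'y in x'I.
case: (billiard_map_spec x'I) => [x'r|x'x'].
  by rewrite x'y in x'r; exact: (reflects_injective x'I xI x'r xy).
by rewrite x'y in x'x'; subst x'; rewrite x'y in yy.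
Qed.

End Polygon.

(** * Equations of chords within an arc and across a node *)

Section Chords.
Variable R : realType.
Implicit Types (s m r : R) (w : R[i]).

Lemma ReD (w1 w2 : R[i]) : complex.Re (w1 + w2) = complex.Re w1 + complex.Re w2.
Proof. by case: w1 w2 => ? ? []. Qed.

Lemma ReB (w1 w2 : R[i]) : complex.Re (w1 - w2) = complex.Re w1 - complex.Re w2.
Proof. by case: w1 w2 => ? ? []. Qed.

Lemma Re_rotate r s m : complex.Re (r%:C * expi s * expi (- m)) = r * cos (s - m).
Proof. by rewrite -mulrA -expiD /expi; simpc. Qed.

(** After rotation by [- m], the direction [arc_tangent m] is the imaginary axis and the real part
    is the normal component. *)
Lemma on_lineP w m : complex.Re (w * expi (- m)) = 0 <->
  exists t : R, w = t%:C * (arc_tangent m).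
Proof.
split=> [E|[t ->]].
  exists (complex.Im (w * expi (- m))).
  have {1}-> : w = w * expi (- m) * expi m.
    by rewrite -mulrA [expi (- m) * _]mulrC expiVr mulr1.
  rewrite /arc_tangent mulrA; congr (_ * _).
  by case: (w * _) E => x y /= ->; simpc.
rewrite /arc_tangent -!mulrA expiVr mulr1.
by simpc.
Qed.

End Chords.

Section PolygonChords.
Variables (R : realType) (G : circular_polygon R).
Local Notation k := (narcs G).
Local Notation a := (angle G).
Local Notation r := (@radius R G).
Local Notation z := (polar (@center R G) (@radius R G) a).

Lemma expi_node (j : 'I_k) : expi (a j.+1) = expi (a (ordS j)).
Proof. exact/arc_tangent_inj/node_C1. Qed.

(** By the C1 condition both centers lie on the common normal at the node. *)
Lemma centerS (j : 'I_k) :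
  center (ordS j) - center j = (r j - r (ordS j))%:C * expi (a j.+1).
Proof.
have := node_C0 j; rewrite /arc_point -expi_node => E.
apply/eqP; rewrite subr_eq rmorphB mulrBl /=.
by rewrite addrAC [X in X - _]addrC E addrK.
Qed.

Lemma Re_chord_same (j : 'I_k) s t m :
  a j <= s < a j.+1 -> a j <= t < a j.+1 ->
  complex.Re ((z t - z s) * expi (- m)) = r j * (cos (t - m) - cos (s - m)).
Proof.
move=> sj tj; rewrite (polar_arc sj) (polar_arc tj) /arc_point.
rewrite opprD addrACA subrr add0r mulrBl ReB !Re_rotate; ring.
Qed.

Lemma Re_chord_next (j : 'I_k) s t d :
  a j <= s < a j.+1 -> a (ordS j) <= t < a (ordS j).+1 ->
  complex.Re ((z t - z s) * expi (- (a j.+1 + d))) =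
  (r j - r (ordS j)) * cos d + r (ordS j) * cos (t - a (ordS j) - d)
  - r j * cos (s - a j.+1 - d).
Proof.
move=> sj tj; rewrite (polar_arc sj) (polar_arc tj) /arc_point.
rewrite opprD addrACA centerS.
(* The last arc is followed by arc 0, so [a j.+1] and [a (ordS j)] agree only modulo [2 * pi]; [t]
   is therefore measured from the node. *)
have -> : expi t = expi (t - a (ordS j) + a j.+1).
  by rewrite expiD expi_node -expiD subrK.
rewrite !mulrDl mulNr ReD ReB !Re_rotate.
rewrite (_ : a j.+1 - (a j.+1 + d) = - d) ?cosN; last ring.
rewrite (_ : t - a (ordS j) + a j.+1 - (a j.+1 + d) = t - a (ordS j) - d); last ring.
rewrite (_ : s - (a j.+1 + d) = s - a j.+1 - d); last ring.
by rewrite [in RHS]mulNr -mulrBl -!addrA; ring.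
Qed.

(* The condition for a chord from an arc of radius [r1] to the next one, of radius
   [r2], to have incidence angles [t1] and [t2], when its mid-angle differs from
   the angle of the node by [d]. *)
Definition crossing_eq (r1 r2 t1 t2 d : R) :=
  r2 * (1 - cos t2) - r1 * (1 - cos t1) = (r2 - r1) * (1 - cos d).

Lemma polar_inj s t : a 0%N <= s < a 0%N + 2 * pi -> a 0%N <= t < a 0%N + 2 * pi ->
  s <> t -> z s <> z t.
Proof. by move=> sD tD st E; apply: st; exact: curve_simple sD tD E. Qed.

Lemma reflects_same_arc (j : 'I_k) s u : 0 < u < pi ->
  a j <= s < a j.+1 -> a j <= s + 2 * u < a j.+1 ->
  reflects G (s, u) (s + 2 * u, u).
Proof.
move=> up sj tj; split => /=.
- by split => //=; exact: arc_domain tj.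
- apply: polar_inj; [exact: arc_domain tj|exact: arc_domain sj|lra].
- have [] := on_lineP (z (s + 2 * u) - z s) (s + u).
  rewrite (Re_chord_same _ sj tj) arc_tangentD.
  rewrite (_ : s + 2 * u - (s + u) = u); last ring.
  rewrite (_ : s - (s + u) = - u); last ring.
  by rewrite cosN subrr mulr0 => /(_ erefl) [t E] _; exists t; rewrite -E [RHS]addrC subrK.
- by rewrite -!arc_tangentD; congr (arc_tangent _); ring.
Qed.

(** The chord should have direction [arc_tangent (a j.+1 + d)], and the crossing equation says that
    its normal component from [Re_chord_next] vanishes. *)
Lemma reflects_next_arc (j : 'I_k) (t1 t2 d : R) :
  0 < t1 < pi -> 0 < t2 < pi ->
  a j <= a j.+1 + d - t1 < a j.+1 ->
  a (ordS j) <= a (ordS j) + d + t2 < a (ordS j).+1 ->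
  a j.+1 + d - t1 <> a (ordS j) + d + t2 ->
  crossing_eq (r j) (r (ordS j)) t1 t2 d ->
  reflects G (a j.+1 + d - t1, t1) (a (ordS j) + d + t2, t2).
Proof.
move=> t1p t2p sj tj st E; split => /=.
- by split => //=; exact: arc_domain tj.
- by apply: polar_inj; [exact: arc_domain tj|exact: arc_domain sj|exact: nesym].
- have [] := on_lineP (z (a (ordS j) + d + t2) - z (a j.+1 + d - t1)) (a j.+1 + d).
  rewrite (Re_chord_next _ sj tj) // -arc_tangentD.
  rewrite (_ : a (ordS j) + d + t2 - a (ordS j) - d = t2); last ring.
  rewrite (_ : a j.+1 + d - t1 - a j.+1 - d = - t1); last ring.
  rewrite (_ : a j.+1 + d - t1 + t1 = a j.+1 + d); last ring.
  rewrite cosN => H _; have [|t Et] := H; last by exists t; rewrite -Et [RHS]addrC subrK.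
  by move: E; rewrite /crossing_eq; lra.
- rewrite -!arc_tangentD /arc_tangent; congr (_ * _).
  transitivity (expi (a (ordS j)) * expi (d + t2)); first by rewrite -expiD addrA.
  by rewrite -expi_node -expiD; congr expi; ring.
Qed.

Lemma reflects_same_arcE (j : 'I_k) x y : phase_interior G x -> reflects G x y ->
  a j <= x.1 < a j.+1 -> a j <= y.1 < a j.+1 -> expi y.1 = expi (x.1 + x.2 + y.2) ->
  x.2 = y.2.
Proof.
move=> [xD xp] [[yD yp] yx [t zy] ty] xj yj Ey.
have : complex.Re ((z y.1 - z x.1) * expi (- (x.1 + x.2))) = 0.
  by apply/on_lineP; exists t; rewrite zy arc_tangentD addrAC subrr add0r.
rewrite (Re_chord_same _ xj yj).
have -> : cos (y.1 - (x.1 + x.2)) = cos y.2.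
  have : expi (y.1 - (x.1 + x.2)) = expi y.2.
    by rewrite expiD Ey -expiD; congr expi; ring.
  by case.
rewrite (_ : x.1 - (x.1 + x.2) = - x.2) ?cosN; last ring.
move/eqP; rewrite mulf_eq0 (gt_eqF (radius_gt0 j)) /= subr_eq0 => /eqP/esym.
by apply: cos_inj; rewrite in_itv /=; lra.
Qed.

Lemma reflects_next_arcE (j : 'I_k) x y d : reflects G x y ->
  a j <= x.1 < a j.+1 -> a (ordS j) <= y.1 < a (ordS j).+1 ->
  x.1 = a j.+1 + d - x.2 -> y.1 = a (ordS j) + d + y.2 ->
  crossing_eq (r j) (r (ordS j)) x.2 y.2 d.
Proof.
move=> [_ yx [t zy] ty] xj yj Ex Ey.
have : complex.Re ((z y.1 - z x.1) * expi (- (a j.+1 + d))) = 0.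
  apply/on_lineP; exists t; rewrite zy -arc_tangentD addrAC subrr add0r Ex.
  by rewrite subrK.
rewrite (Re_chord_next _ xj yj) // Ex Ey.
rewrite (_ : a (ordS j) + d + y.2 - a (ordS j) - d = y.2); last ring.
rewrite (_ : a j.+1 + d - x.2 - a j.+1 - d = - x.2); last ring.
by rewrite cosN /crossing_eq; lra.
Qed.

Lemma reflects_expi x y : reflects G x y -> expi y.1 = expi (x.1 + x.2 + y.2).
Proof.
by case=> _ _ _ ty; apply: arc_tangent_inj; rewrite ty -!arc_tangentD.
Qed.

End PolygonChords.

(** * Quadratic bounds for the cosine and the loss of angle at a node *)

Section CosineBounds.
Variable R : realType.
Implicit Types x y : R.

Lemma sin_cos_mul x : 0 < x -> exists2 y : R, 0 < y < x & sin x = cos y * x.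
Proof.
move=> x0; have X := @MVT R sin cos 0 x x0.
have [|y yx Y] := X (fun y _ => is_derive_sin y).
  by apply: continuous_subspaceT; exact: continuous_sin.
by exists y => //; move: Y; rewrite sin0 !subr0.
Qed.

Lemma sqr_sin_le x : sin x ^+ 2 <= x ^+ 2.
Proof.
wlog x0 : x / 0 < x => [H|].
  case: (ltrgtP x 0) => [x0|x0|->]; [|exact: H|by rewrite sin0].
  by rewrite -[sin x ^+ 2]sqrrN -sinN -(sqrrN x); apply: H; rewrite oppr_gt0.
have [y _ ->] := sin_cos_mul x0.
by rewrite exprMn ler_piMl ?sqr_ge0 // cos2sin2 gerBl sqr_ge0.
Qed.

Lemma one_sub_cos_le x : 1 - cos x <= x ^+ 2 / 2.
Proof. by rewrite (cos_half x); have := sqr_sin_le (x / 2); lra. Qed.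

(** Here [1 - cos x = 2 * (cos y * (x / 2)) ^+ 2] for some [y] between 0 and [x / 2], and
    [cos y >= 1 - x ^+ 2 / 8], whose square exceeds [1 - x ^+ 2 / 4]. *)
Lemma one_sub_cos_ge x : `|x| <= 2 -> x ^+ 2 / 2 * (1 - x ^+ 2 / 4) <= 1 - cos x.
Proof.
wlog x0 : x / 0 < x => [H|].
  case: (ltrgtP x 0) => [x0|x0|->]; [|exact: H|by rewrite cos0; lra].
  by rewrite -normrN -(cosN x) -(sqrrN x); apply: H; rewrite oppr_gt0.
rewrite gtr0_norm // => x2.
have [|y /andP[y0 yx] E] := @sin_cos_mul (x / 2); first by rewrite divr_gt0.
rewrite (cos_half x) E.
have cy : 1 - (x / 2) ^+ 2 / 2 <= cos y.
  have := one_sub_cos_le y; have : y ^+ 2 <= (x / 2) ^+ 2.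
    by rewrite ler_pXn2r ?nnegrE //; lra.
  lra.
have : 0 <= (x / 2) ^+ 2 * ((cos y + (1 - (x / 2) ^+ 2 / 2)) * (cos y - (1 - (x / 2) ^+ 2 / 2))).
  rewrite mulr_ge0 ?sqr_ge0 // mulr_ge0 ?subr_ge0 //.
  have : x ^+ 2 <= 2 ^+ 2 by rewrite ler_pXn2r ?nnegrE //; lra.
  lra.
have : 0 <= (x / 2) ^+ 2 * (x ^+ 2 / 8) ^+ 2 by rewrite mulr_ge0 ?sqr_ge0.
nra.
Qed.

Lemma cos_le_norm x y : `|x| <= `|y| -> `|y| <= pi -> cos y <= cos x.
Proof.
move=> xy yp; rewrite -(cos_norm x) -(cos_norm y).
case: (ltrgtP `|x| `|y|) xy => // [xy _|-> //].
by apply/ltW; rewrite ltr_cos // in_itv /= ?normr_ge0 //= (le_trans (ltW xy)).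
Qed.

(** If [r1 <= r2], the right side of the crossing equation is nonnegative, which gives
    [r1 * (1 - cos t1) <= r2 * (1 - cos t2)]. Otherwise [d] is bounded by [t1] or by [t2] in
    absolute value, according to its sign, and [1 - cos t1 <= 1 - cos t2]. The factor 2 before
    [g ^+ 2] absorbs the passage from cosines to squares. *)
Lemma crossing_lower (r1 r2 t1 t2 d g : R) : 0 < r1 -> 0 < r2 -> 0 < g ->
  2 * g ^+ 2 * r2 <= r1 -> 2 * g ^+ 2 <= 1 -> 0 < t1 <= 1 -> 0 < t2 <= 1 ->
  - t2 <= d <= t1 -> crossing_eq r1 r2 t1 t2 d -> g * t1 <= t2.
Proof.
move=> r1p r2p gp gr g1 t1p t2p dp; rewrite /crossing_eq => E.
have pi2 := pi_ge2 R.
have H : 2 * g ^+ 2 * (1 - cos t1) <= 1 - cos t2.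
  have A1 : 0 <= 1 - cos t1 by rewrite subr_ge0 cos_le1.
  have A2 : 0 <= 1 - cos d by rewrite subr_ge0 cos_le1.
  have g0 : 0 < 2 * g ^+ 2 by rewrite mulr_gt0 // exprn_gt0.
  case: (leP r1 r2) => r12.
    rewrite -(ler_pM2l r2p).
    have := ler_wpM2r A1 gr.
    have : 0 <= (r2 - r1) * (1 - cos d) by rewrite mulr_ge0 // subr_ge0.
    lra.
  have gA : 2 * g ^+ 2 * (1 - cos t1) <= 1 - cos t1 by rewrite ler_piMl.
  apply: le_trans gA _.
  case: (leP 0 d) => d0.
    rewrite -(ler_pM2l r2p).
    have : cos t1 <= cos d by apply: cos_le_norm; rewrite ger0_norm ?ger0_norm; lra.
    move=> dt; have : 0 <= (r1 - r2) * (cos d - cos t1).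
      by rewrite mulr_ge0 // subr_ge0 // ltW.
    lra.
  rewrite -(ler_pM2l r1p).
  have : cos t2 <= cos d.
    by apply: cos_le_norm; rewrite ?(ltr0_norm d0) ger0_norm; lra.
  move=> dt; have : 0 <= (r1 - r2) * (cos d - cos t2).
    by rewrite mulr_ge0 // subr_ge0 // ltW.
  lra.
have t1n : `|t1| <= 2 by rewrite ger0_norm; lra.
have H1 := one_sub_cos_ge t1n.
have H2 := one_sub_cos_le t2.
have t1s : t1 ^+ 2 <= 1 by rewrite expr_le1 //; lra.
have H3 : t1 ^+ 2 / 4 <= 1 - cos t1.
  apply: le_trans H1; rewrite -subr_ge0.
  have : 0 <= t1 ^+ 2 * (1 - t1 ^+ 2) by rewrite mulr_ge0 ?sqr_ge0 // subr_ge0.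
  have : 0 <= t1 ^+ 2 by rewrite sqr_ge0.
  lra.
have : 2 * g ^+ 2 * (t1 ^+ 2 / 4) <= 2 * g ^+ 2 * (1 - cos t1).
  by rewrite ler_pM2l // mulr_gt0 // exprn_gt0.
move=> H4.
have : (g * t1) ^+ 2 <= t2 ^+ 2 by rewrite exprMn; lra.
by rewrite ler_pXn2r // nnegrE; [rewrite mulr_ge0 // ?ltW //; lra | lra].
Qed.

End CosineBounds.

(** Source of all constants that are uniform over arcs or pairs of arcs. The cap 1 gives a value
    when no index satisfies [P]. *)
Lemma finite_lower_bound (R : realType) (T : finType) (P : pred T) (f : T -> R) :
  (forall x, P x -> 0 < f x) ->
  exists2 e : R, 0 < e <= 1 & forall x, P x -> e <= f x.
Proof.
move=> f0; exists (\big[Num.min/1]_(x | P x) f x).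
  rewrite bigmin_le_id andbT.
  by apply/bigmin_gtP; split.
by move=> x Px; exact: bigmin_le_cond.
Qed.

Lemma arc_length_gt0 (R : realType) (G : circular_polygon R) (j : 'I_(narcs G)) :
  0 < angle G j.+1 - angle G j.
Proof. by rewrite subr_gt0 angle_lt. Qed.

(** * Optimality of linear speed *)

Section NotFaster.
Variables (R : realType) (G : circular_polygon R).
Local Notation k := (narcs G).
Local Notation a := (angle G).
Local Notation r := (@radius R G).
Local Notation f := (billiard_map G).

Variables lam g : R.
Hypothesis lam1 : lam <= 1.
Hypothesis lam_le : forall j : 'I_k, lam <= a j.+1 - a j.
Hypothesis g_gt0 : 0 < g.
Hypothesis g1 : 2 * g ^+ 2 <= 1.
Hypothesis gr : forall i j : 'I_k, 2 * g ^+ 2 * r i <= r j.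

(** An advance shorter than every arc passes at most one node. The position bounds in the second
    case serve to rule out another node soon after. *)
Lemma small_step (j : 'I_k) x : phase_interior G x -> a j <= x.1 < a j.+1 ->
  x.2 + (f x).2 < lam ->
  [/\ a j <= (f x).1 < a j.+1, (f x).2 = x.2 & (f x).1 <= x.1 + x.2 + (f x).2] \/
  [/\ a (ordS j) <= (f x).1 < a (ordS j).+1, g * x.2 <= (f x).2,
      (f x).1 <= a (ordS j) + x.2 + (f x).2 & a j.+1 <= x.1 + x.2 + (f x).2].
Proof.
move=> xI xj small.
have x0 : 0 < x.2 by case: xI => _ /andP[].
case: (billiard_map_spec xI) => [xy|fx]; last first.
  by left; rewrite fx; split => //; lra.
move: (f x) xy small => y xy small.
have [yD yp] : phase_interior G y by case: xy.
have Ey := reflects_expi xy.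
case: (ltP (x.1 + x.2 + y.2) (a j.+1)) => s_lt.
  left; have y1 : y.1 = x.1 + x.2 + y.2.
    apply: expi_inj Ey; first exact: yD.
    by apply: (@arc_domain _ _ j); lra.
  have yj : a j <= y.1 < a j.+1 by lra.
  by split => //; [rewrite (reflects_same_arcE xI xy xj yj Ey) | rewrite y1].
right; set s := x.1 + x.2 + y.2 - a j.+1 + a (ordS j).
have lamS := lam_le (ordS j).
have sD : a (ordS j) <= s < a (ordS j).+1 by rewrite /s; lra.
have y1 : y.1 = s.
  apply: expi_inj yD (arc_domain sD) _.
  rewrite Ey /s [in RHS]expiD -expi_node -expiD; congr expi; ring.
split => //; [by rewrite y1| |by rewrite y1 /s; lra].
apply: (@crossing_lower _ (r j) (r (ordS j)) _ _ (x.1 + x.2 - a j.+1)) => //.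
- exact: radius_gt0.
- exact: radius_gt0.
- case/andP: yp => y0 _; rewrite x0 /=; have := lam1; lra.
- by case/andP: yp => y0 _; rewrite y0 /=; have := lam1; lra.
- lra.
- by apply: reflects_next_arcE xy xj _ _ _; rewrite ?y1 //; [ring | rewrite /s; ring].
Qed.

Lemma phase_interior_map x : phase_interior G x -> phase_interior G (f x).
Proof. by move=> xI; case: (billiard_map_spec xI) => [[]|->]. Qed.

Lemma phase_interior_iter n x : phase_interior G x -> phase_interior G (iter n f x).
Proof. by move=> xI; elim: n => //= n; exact: phase_interior_map. Qed.

(* Over a window of total advance less than every arc, at most one node is passed. *)
Lemma window_lower x M (delta : R) : phase_interior G x ->
  (forall q, (q <= M)%N -> (iter q f x).2 <= delta) ->
  2 * delta * M%:R < lam -> g * x.2 <= (iter M f x).2.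
Proof.
move=> xI small.
have [xD /andP[x0 _]] := xI.
have delta0 : 0 < delta by exact: lt_le_trans (small 0%N (leq0n _)).
have [j xj] := arc_exists xD.
move=> Ml.
have gle1 : g <= 1.
  rewrite leNgt; apply/negP => H; have : 1 < g ^+ 2 by rewrite expr_gt1 // ltW.
  by have := g1; lra.
suff H q : (q <= M)%N ->
    (a j <= (iter q f x).1 < a j.+1 /\ (iter q f x).2 = x.2) \/
    [/\ a (ordS j) <= (iter q f x).1 < a (ordS j).+1, g * x.2 <= (iter q f x).2 &
       (iter q f x).1 - a (ordS j) <= 2 * delta * q%:R].
  have [[_ ->]|[_ //]] := H M (leqnn _).
  by rewrite ler_piMl // ltW.
elim: q => [_|q IH qM]; first by left.
have yI := phase_interior_iter q xI.
have small0 := small q (ltnW qM).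
have small1 := small q.+1 qM.
have dq : 2 * delta * q.+1%:R < lam.
  by apply: le_lt_trans Ml; rewrite ler_wpM2l ?ler_nat //; lra.
have dqE : 2 * delta * q.+1%:R = 2 * delta * q%:R + 2 * delta.
  by rewrite -natr1; ring.
have dq0 : 0 <= 2 * delta * q%:R by rewrite mulr_ge0 //; lra.
rewrite iterS in small1 *.
move: (iter q f x) yI small0 small1 (IH (ltnW qM)) => y yI s0 s1 {IH} [[yj y2]|[yj y2 y1]].
- have [|[fj f2 f1]|[fj f2 f1 f3]] := small_step yI yj; first lra.
    by left; rewrite f2.
  by right; split => //; [rewrite -y2|lra].
- have lamS := lam_le (ordS j).
  have [|[fj f2 f1]|[fj f2 f1 f3]] := small_step yI yj; first lra.
    by right; rewrite f2; split => //; lra.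
  (* A second node would require the length of a whole arc, at least [lam], to be covered within the
     window. *)
  by exfalso; lra.
Qed.

End NotFaster.

Lemma not_faster_than_linear (R : realType) (G : circular_polygon R) x :
  phase_interior G x ->
  ~ (fun n : nat => n%:R * (billiard_iter G (n%:Z) x).2) @ \oo --> (0 : R).
Proof.
move=> xI ucv.
set u := fun n : nat => n%:R * (iter n (billiard_map G) x).2.
have {}ucv : u @ \oo --> (0 : R) by exact: ucv.
have [lam /andP[lam0 lam1] lam_le] := @finite_lower_bound R _ predT
  (fun j : 'I_(narcs G) => angle G j.+1 - angle G j)
  (fun j _ => arc_length_gt0 j).
have [q /andP[q0 q1] qr] := @finite_lower_bound R _ predT
  (fun ij : 'I_(narcs G) * 'I_(narcs G) => radius ij.2 / radius ij.1 / 2)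
  (fun ij _ => divr_gt0 (divr_gt0 (radius_gt0 _) (radius_gt0 _)) (ltr0Sn _ 1)).
(* As [q] is at most 1 and at most half of every ratio of radii, [2 * g ^+ 2 <= q / 2] yields both
   conditions on [g]. *)
pose g := q / 2.
have g0 : 0 < g by rewrite divr_gt0.
have gq : 2 * g ^+ 2 <= q / 2.
  rewrite /g; have : 0 <= q * (1 - q) by rewrite mulr_ge0 ?subr_ge0 // ltW.
  lra.
have gr (i j : 'I_(narcs G)) : 2 * g ^+ 2 * radius i <= radius j.
  have ri := radius_gt0 i.
  rewrite -ler_pdivlMr //; have := qr (i, j) isT; rewrite /=.
  have : 0 < radius j / radius i by rewrite divr_gt0 ?radius_gt0.
  lra.
pose K := (Num.truncn (g^-1)).+2.
have gK : 1 <= g * K%:R.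
  rewrite -ler_pdivrMl // mulr1 /K -natr1.
  by have := truncnS_gt (g^-1); lra.
(* From time [n] to [K * n] the angle is then at most [d = lam / (4 * K) / n], so the total advance
   is at most [2 * d * K * n = lam / 2]. *)
have [N0 _ uN0] : \forall n \near \oo, `|u n| <= lam / (4 * K%:R).
  by move/cvgr0_norm_le : ucv; apply; rewrite divr_gt0 // mulr_gt0 // ltr0n.
have upos n : (0 < n)%N -> 0 < u n.
  move=> n0; rewrite /u mulr_gt0 ?ltr0n //.
  by have [_ /andP[]] := phase_interior_iter n xI.
have grow n : (N0 <= n)%N -> (0 < n)%N -> u n <= u (K * n)%N.
  move=> nN n0.
  have n0R : 0 < n%:R :> R by rewrite ltr0n.
  have K0 : 0 < K%:R :> R by rewrite ltr0n.
  pose d := lam / (4 * K%:R) / n%:R.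
  have H : g * (iter n (billiard_map G) x).2 <= (iter (K * n) (billiard_map G) x).2.
    have -> : (K * n = (K * n - n) + n)%N by rewrite subnK // leq_pmull.
    rewrite iterD.
    apply: (@window_lower _ _ lam g lam1 (fun j => lam_le j isT) _ _ _ _ _ d) => //.
    - lra.
    - exact: phase_interior_iter.
    - move=> p _; rewrite -iterD.
      have pn : (0 < p + n)%N by rewrite addn_gt0 n0 orbT.
      have := uN0 (p + n)%N (leq_trans nN (leq_addl _ _)).
      rewrite gtr0_norm ?upos // /u => {}H.
      rewrite /d ler_pdivlMr // mulrC; apply: le_trans H.
      rewrite ler_wpM2r ?ler_nat ?leq_addl //.
      by have [_ /andP[/ltW]] := phase_interior_iter (p + n) xI.
    - rewrite /d; apply: (@le_lt_trans _ _ (2 * (lam / (4 * K%:R) / n%:R) * (K * n)%:R)).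
        rewrite ler_wpM2l ?ler_nat ?leq_subr // mulr_ge0 // ltW //.
        by rewrite !divr_gt0 // mulr_gt0.
      have -> : 2 * (lam / (4 * K%:R) / n%:R) * (K * n)%:R = lam / 2 :> R.
        by rewrite natrM; field; rewrite !gt_eqF.
      lra.
  rewrite /u natrM.
  apply: (@le_trans _ _ (K%:R * n%:R * (g * (iter n (billiard_map G) x).2))); last first.
    by rewrite ler_wpM2l // mulr_ge0 // ltW.
  rewrite (_ : K%:R * n%:R * _ = (g * K%:R) * u n) /u; last by ring.
  by rewrite ler_peMl // ltW // upos.
(* Along the times [K ^ m * N0.+1] the sequence does not fall below its positive initial value. *)
have growm m : u N0.+1 <= u (K ^ m * N0.+1)%N.
  elim: m => [|m IH]; first by rewrite expn0 mul1n.
  have L : (N0.+1 <= K ^ m * N0.+1)%N by rewrite leq_pmull // expn_gt0.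
  by apply: le_trans IH _; rewrite expnS -mulnA; apply: grow; apply: leq_trans L.
have [N1 _ uN1] : \forall n \near \oo, `|u n| < u N0.+1.
  by move/cvgr0_norm_lt : ucv; apply; exact: upos.
have L : (N1 <= K ^ N1 * N0.+1)%N.
  by apply: leq_trans (leq_pmulr _ _) => //; rewrite ltnW // ltn_expl.
have := uN1 _ L; rewrite gtr0_norm ?upos ?muln_gt0 ?expn_gt0 //.
by rewrite ltNge growm.
Qed.

(** * Zeros of monotone systems by suprema of subsolutions *)

(* As the residual at [i] increases with the values at the neighbours of [i], the
   pointwise supremum of the subsolutions in the box is a solution. *)
Section MonotoneZero.
Variables (R : realType) (I : eqType) (prv nxt : I -> I).
Hypothesis prv_neq : forall i, prv i != i.
Hypothesis nxt_neq : forall i, nxt i != i.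
Variables (lo hi : I -> R) (E : I -> R -> R -> R -> R).

Let inbox (d : I -> R) := forall i, lo i <= d i <= hi i.
Let residual (d : I -> R) i := E i (d (prv i)) (d i) (d (nxt i)).

Hypothesis lo_le_hi : forall i, lo i <= hi i.
Hypothesis E_mono : forall (d d' : I -> R) i, inbox d -> inbox d' ->
  (forall j, d j <= d' j) -> d i = d' i -> residual d i <= residual d' i.
Hypothesis E_cont : forall i p n, continuous (fun x => E i p x n).
Hypothesis E_lo : forall i, 0 <= residual lo i.
Hypothesis E_hi : forall i, residual hi i <= 0.

Let sub : set (I -> R) := [set d | inbox d /\ forall i, 0 <= residual d i].
Let D i : R := sup [set d i | d in sub].

Let lo_sub : sub lo.
Proof. by split => // i; rewrite lexx lo_le_hi. Qed.

Let D_ub d : sub d -> forall i, d i <= D i.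
Proof.
move=> ds i; apply: ub_le_sup; last by exists d.
by exists (hi i) => _ [d' [d'b _] <-]; case/andP: (d'b i).
Qed.

Let D_box : inbox D.
Proof.
move=> i; rewrite D_ub //=; apply: ge_sup; first by exists (lo i); exists lo.
by move=> _ [d' [d'b _] <-]; case/andP: (d'b i).
Qed.

Let near_gt0 (f : R -> R) x : continuous f -> 0 < f x ->
  exists2 e : R, 0 < e & forall y, `|x - y| < e -> 0 < f y.
Proof.
move=> fc fx; have : \forall y \near x, 0 < f y.
  have := fc x; move/cvgr_gt; exact.
by case/nbhs_ballP => e e0 H; exists e => // y xy; apply: H.
Qed.

Let update (d : I -> R) i x : I -> R := fun j => if j == i then x else d j.

Let D_residual_ge0 i : 0 <= residual D i.
Proof.
rewrite leNgt; apply/negP => neg.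
have [||e e0 He] := @near_gt0 (fun x => - E i (D (prv i)) x (D (nxt i))) (D i).
- by move=> x; apply: continuousN; exact: E_cont.
- by rewrite oppr_gt0.
have hs : has_sup [set d i | d in sub].
  split; first by exists (lo i); exists lo.
  by exists (hi i) => _ [d' [d'b _] <-]; case/andP: (d'b i).
have [_ [d ds <-] di] := sup_adherent e0 hs.
rewrite -/(D i) in di.
have dD : d i <= D i by exact: D_ub.
have : 0 < - E i (D (prv i)) (d i) (D (nxt i)).
  by apply: He; rewrite ger0_norm ?subr_ge0 // ltrBlDr -ltrBlDl.
rewrite oppr_gt0 => neg'.
have [db d0] := ds.
(* Raising [d] to [D] everywhere except at [i] cannot decrease the residual at [i], which ends up
   negative; yet that of [d] is nonnegative. *)
have Ub : inbox (update D i (d i)).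
  by move=> j; rewrite /update; case: eqP => [->|_].
have := E_mono (i := i) db Ub.
rewrite {2}/residual /update (negPf (prv_neq i)) (negPf (nxt_neq i)) eqxx => H.
have := d0 i; rewrite leNgt => /negP; apply.
apply: le_lt_trans neg'; apply: H => // j.
by case: eqP => [->//|_]; exact: D_ub.
Qed.

Lemma monotone_zero : exists d : I -> R,
  (forall i, lo i <= d i <= hi i) /\ forall i, E i (d (prv i)) (d i) (d (nxt i)) = 0.
Proof.
exists D; split=> [|i]; first exact: D_box.
apply/eqP; rewrite eq_le [X in _ && X]D_residual_ge0 andbT.
rewrite leNgt; apply/negP => pos.
have [|e e0 He] := @near_gt0 (fun x => E i (D (prv i)) x (D (nxt i))) (D i) _ pos.
  exact: E_cont.
have hib : inbox hi by move=> j; rewrite lexx lo_le_hi.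
have Dhi : D i < hi i.
  rewrite lt_neqAle; case/andP: (D_box i) => _ ->; rewrite andbT; apply/eqP => Ei.
  have H := E_mono D_box hib (fun j => proj2 (andP (D_box j))) Ei.
  have := lt_le_trans pos (le_trans H (E_hi i)).
  by rewrite ltxx.
(* A rise at [i] by less than [e] keeps the residual positive there by continuity and nonnegative
   elsewhere by monotonicity, so a subsolution would exceed the supremum. *)
pose x := Num.min (hi i) (D i + e / 2).
have Dx : D i < x by rewrite /x lt_min Dhi /= ltrDl divr_gt0.
have : sub (update D i x).
  have Ub : inbox (update D i x).
    move=> j; rewrite /update; case: eqP => [->|_ //].
    rewrite /x ge_min lexx /= andbT (le_trans _ (ltW Dx)) //.
    by case/andP: (D_box i).
  split=> // j; case: (eqVneq j i) => [->|ji].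
    rewrite /residual /update (negPf (prv_neq i)) (negPf (nxt_neq i)) eqxx.
    apply/ltW/He; rewrite distrC ger0_norm ?subr_ge0 ?ltW //.
    rewrite ltrBlDl; apply: (@le_lt_trans _ _ (D i + e / 2)).
      by rewrite /x ge_min lexx orbT.
    by rewrite ltrD2l; lra.
  apply: le_trans (D_residual_ge0 j) _; apply: E_mono => //.
    by move=> l; rewrite /update; case: eqP => [->|//]; exact: ltW.
  by rewrite /update (negPf ji).
move/D_ub => /(_ i); rewrite /update eqxx => /(lt_le_trans Dx).
by rewrite ltxx.
Qed.

End MonotoneZero.

(** * Signs of the crossing equation at the two ends of the offset interval *)

Section NodeEstimates.
Variable R : realType.

Lemma one_sub_cos_bounds (e x : R) : 0 <= e <= 1 -> x ^+ 2 <= 4 * e ->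
  (1 - e) * (x ^+ 2 / 2) <= 1 - cos x <= x ^+ 2 / 2.
Proof.
move=> e01 xe; rewrite one_sub_cos_le andbT.
have x2 : `|x| <= 2.
  have : x ^+ 2 <= 2 ^+ 2 by lra.
  by rewrite -(real_normK (num_real x)) ler_pXn2r ?nnegrE.
apply: le_trans (one_sub_cos_ge x2); rewrite mulrC ler_wpM2l //; last lra.
by rewrite divr_ge0 // sqr_ge0.
Qed.

(* [q ^ 2] is the ratio of the smaller radius (primed data) to the larger one.
   Incidence angles proportional to [radius ^ (- 1 / 4)] have [T / T' = sqrt q], up
   to a factor [1 + e]; the crossing equation then has opposite signs at the
   offsets [2 * e * T] and [(1 - 2 * e) * T], and its slack at the latter is
   [q * (1 - q)] for [e = 0]. *)
Variables (q e T T' th th' : R).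
Hypothesis q01 : 0 < q < 1.
Hypothesis e0 : 0 < e.
Hypothesis eq22 : 22 * e <= q * (1 - q).
Hypothesis T0 : 0 < T.
Hypothesis T0' : 0 < T'.
Hypothesis TT' : q * T' ^+ 2 <= (1 + e) ^+ 2 * T ^+ 2.
Hypothesis T'T : T ^+ 2 <= q * (1 + e) ^+ 2 * T' ^+ 2.
Hypothesis thT : (1 - e) * T <= th <= (1 + e) * T.
Hypothesis thT' : (1 - e) * T' <= th' <= (1 + e) * T'.
Hypothesis small : T ^+ 2 <= e.
Hypothesis small' : T' ^+ 2 <= e.

Let e88 : 88 * e <= 1.
Proof.
have := eq22; have : 0 <= (q - 1 / 2) ^+ 2 by rewrite sqr_ge0.
lra.
Qed.

Let sq_bounds (t s : R) : 0 < s -> (1 - e) * s <= t <= (1 + e) * s ->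
  (1 - e) ^+ 2 * s ^+ 2 <= t ^+ 2 <= (1 + e) ^+ 2 * s ^+ 2.
Proof.
move=> s0 /andP[st ts]; have E0 := e0; have E88 := e88.
have s1 : 0 < (1 - e) * s by rewrite mulr_gt0 //; lra.
rewrite -!exprMn !ler_pXn2r ?nnegrE ?st ?ts //; lra.
Qed.

Let pow_le : (1 + e) ^+ 2 <= 1 + 3 * e /\ (1 + e) ^+ 4 <= 1 + 5 * e.
Proof. have E0 := e0; have E88 := e88; split; nra. Qed.

Let pow_ge : 1 - 3 * e <= (1 - e) ^+ 3.
Proof. have E0 := e0; have E88 := e88; nra. Qed.

Let pow_ge' : (1 - 5 * e) * (1 + e) ^+ 2 <= (1 - e) ^+ 3.
Proof. have E0 := e0; have E88 := e88; nra. Qed.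

Let pow_ge'' : 1 - 5 * e <= (1 - e) * (1 - 2 * e) ^+ 2.
Proof. have E0 := e0; have E88 := e88; nra. Qed.

Let sq_small (t s : R) : 0 < s -> (1 - e) * s <= t <= (1 + e) * s -> s ^+ 2 <= e ->
  t ^+ 2 <= 4 * e.
Proof.
move=> s0 ts se; have /andP[_ H] := sq_bounds s0 ts.
have [P _] := pow_le; have E0 := e0; have E88 := e88.
have : (1 + e) ^+ 2 * s ^+ 2 <= (1 + 3 * e) * s ^+ 2 by rewrite ler_wpM2r ?sqr_ge0.
have : (1 + 3 * e) * s ^+ 2 <= 2 * s ^+ 2 by rewrite ler_wpM2r ?sqr_ge0 //; lra.
lra.
Qed.

Lemma node_order : T <= T'.
Proof.
rewrite -(@ler_pXn2r _ 2) // ?nnegrE ?(ltW T0) ?(ltW T0') //.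
apply: le_trans T'T _; rewrite ler_piMl ?sqr_ge0 //.
have [P _] := pow_le; case/andP: q01 => q0 q1.
have : q * (1 + e) ^+ 2 <= q * (1 + 3 * e) by rewrite ler_pM2l.
have : 0 <= e * (1 - q) by rewrite mulr_ge0 ?subr_ge0 // ltW.
have : 0 <= (1 - q) * (1 - q) by rewrite mulr_ge0 // subr_ge0 ltW.
have := eq22; have := e0; lra.
Qed.

(** In units of [T ^+ 2 / 2] the left side is at most [q * (1 + 5 * e) + e] and the right side at
    least [1 - 3 * e]; the gap [1 - q >= 22 * e] covers the errors. *)
Lemma node_outer : q ^+ 2 * (1 - cos th') + (1 - q ^+ 2) * (1 - cos (2 * e * T))
  <= 1 - cos th.
Proof.
have E0 := e0; have E88 := e88; have E22 := eq22; case/andP: q01 => q0 q1.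
have [P2 P4] := pow_le.
have X0 : 0 < T ^+ 2 by rewrite exprn_gt0.
have [_ H1] := andP (sq_bounds T0' thT').
have [H2 _] := andP (sq_bounds T0 thT).
have C1 := one_sub_cos_le th'.
have C2 := one_sub_cos_le (2 * e * T).
have [|C3 _] := andP (@one_sub_cos_bounds e th _ (sq_small T0 thT small)); first lra.
have A1 : q ^+ 2 * (1 - cos th') <= q * (1 + 5 * e) * (T ^+ 2 / 2).
  apply: (@le_trans _ _ (q ^+ 2 * ((1 + e) ^+ 2 * T' ^+ 2 / 2))).
    by rewrite ler_wpM2l ?sqr_ge0 //; lra.
  have -> : q ^+ 2 * ((1 + e) ^+ 2 * T' ^+ 2 / 2) = q * (1 + e) ^+ 2 / 2 * (q * T' ^+ 2).
    by field.
  apply: (@le_trans _ _ (q * (1 + e) ^+ 2 / 2 * ((1 + e) ^+ 2 * T ^+ 2))).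
    by rewrite ler_wpM2l // divr_ge0 // mulr_ge0 ?sqr_ge0 // ltW.
  have -> : q * (1 + e) ^+ 2 / 2 * ((1 + e) ^+ 2 * T ^+ 2) = q * (1 + e) ^+ 4 * (T ^+ 2 / 2).
    by field.
  by rewrite ler_wpM2r ?divr_ge0 ?sqr_ge0 // ler_pM2l.
have A2 : (1 - q ^+ 2) * (1 - cos (2 * e * T)) <= e * (T ^+ 2 / 2).
  apply: (@le_trans _ _ (1 * ((2 * e * T) ^+ 2 / 2))).
    apply: ler_pM => //; rewrite ?subr_ge0 ?cos_le1 //.
      by rewrite expr_le1 // ltW.
    by rewrite gerBl sqr_ge0.
  have -> : 1 * ((2 * e * T) ^+ 2 / 2) = 4 * e ^+ 2 * (T ^+ 2 / 2) by field.
  rewrite ler_wpM2r ?divr_ge0 ?sqr_ge0 //.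
  have : 0 <= e * (1 - 4 * e) by rewrite mulr_ge0 //; lra.
  lra.
have A3 : (1 - 3 * e) * (T ^+ 2 / 2) <= 1 - cos th.
  apply: le_trans C3.
  apply: (@le_trans _ _ ((1 - e) ^+ 3 * (T ^+ 2 / 2))).
    by rewrite ler_wpM2r // divr_ge0 // sqr_ge0.
  have -> : (1 - e) ^+ 3 * (T ^+ 2 / 2) = (1 - e) * ((1 - e) ^+ 2 * T ^+ 2 / 2) by field.
  by rewrite ler_wpM2l //; lra.
have : 0 <= (1 - 3 * e - e - q * (1 + 5 * e)) * (T ^+ 2 / 2).
  rewrite mulr_ge0 ?divr_ge0 ?sqr_ge0 //.
  have : 0 <= e * (1 - q) by rewrite mulr_ge0 ?subr_ge0 // ltW.
  have : 0 <= (1 - q) * (1 - q) by rewrite mulr_ge0 // subr_ge0 ltW.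
  lra.
lra.
Qed.

(** In units of [T ^+ 2 / 2] the left side is at most [1 + 3 * e] and the right side at least
    [(1 + q * (1 - q)) * (1 - 5 * e)]; the slack [q * (1 - q) >= 22 * e] covers the errors. *)
Lemma node_inner : 1 - cos th <=
  q ^+ 2 * (1 - cos th') + (1 - q ^+ 2) * (1 - cos ((1 - 2 * e) * T)).
Proof.
have E0 := e0; have E88 := e88; have E22 := eq22; case/andP: q01 => q0 q1.
have [P2 P4] := pow_le.
have X0 : 0 < T ^+ 2 by rewrite exprn_gt0.
have [H1 _] := andP (sq_bounds T0' thT').
have [_ H2] := andP (sq_bounds T0 thT).
have C1 := one_sub_cos_le th.
have [|C2 _] := andP (@one_sub_cos_bounds e th' _ (sq_small T0' thT' small')); first lra.
have [||C3 _] := andP (@one_sub_cos_bounds e ((1 - 2 * e) * T) _ _); first lra.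
  have Sm := small; rewrite exprMn; apply: (@le_trans _ _ (1 * T ^+ 2)); last lra.
  by rewrite ler_wpM2r ?sqr_ge0 // expr_le1 //; lra.
have A1 : q * (1 - 5 * e) * (T ^+ 2 / 2) <= q ^+ 2 * (1 - cos th').
  apply: (@le_trans _ _ (q ^+ 2 * ((1 - e) ^+ 3 * T' ^+ 2 / 2))); last first.
    rewrite ler_wpM2l ?sqr_ge0 //; apply: le_trans C2.
    have -> : (1 - e) ^+ 3 * T' ^+ 2 / 2 = (1 - e) * ((1 - e) ^+ 2 * T' ^+ 2 / 2) by field.
    by rewrite ler_wpM2l //; lra.
  apply: (@le_trans _ _ (q ^+ 2 * ((1 - 5 * e) * (1 + e) ^+ 2 * T' ^+ 2 / 2))); last first.
    by rewrite ler_wpM2l ?sqr_ge0 // !ler_wpM2r ?sqr_ge0 // invr_ge0.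
  have -> : q ^+ 2 * ((1 - 5 * e) * (1 + e) ^+ 2 * T' ^+ 2 / 2) =
    q * (1 - 5 * e) / 2 * (q * (1 + e) ^+ 2 * T' ^+ 2) by field.
  have -> : q * (1 - 5 * e) * (T ^+ 2 / 2) = q * (1 - 5 * e) / 2 * T ^+ 2 by field.
  by rewrite ler_wpM2l // divr_ge0 // mulr_ge0 // ?ltW //; lra.
have A2 : (1 - q ^+ 2) * ((1 - 5 * e) * (T ^+ 2 / 2)) <=
    (1 - q ^+ 2) * (1 - cos ((1 - 2 * e) * T)).
  rewrite ler_wpM2l ?subr_ge0 ?expr_le1 ?(ltW q1) ?(ltW q0) //.
  apply: le_trans C3; rewrite exprMn.
  have -> : (1 - e) * ((1 - 2 * e) ^+ 2 * T ^+ 2 / 2) =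
     (1 - e) * (1 - 2 * e) ^+ 2 * (T ^+ 2 / 2) by field.
  by rewrite ler_wpM2r ?divr_ge0 ?sqr_ge0.
have A3 : 1 - cos th <= (1 + 3 * e) * (T ^+ 2 / 2).
  apply: (le_trans C1); apply: (@le_trans _ _ ((1 + e) ^+ 2 * T ^+ 2 / 2)); first lra.
  by rewrite [X in _ <= X]mulrA ler_wpM2r ?invr_ge0 // ler_pM2r.
have : 0 <= (q * (1 - 5 * e) + (1 - q ^+ 2) * (1 - 5 * e) - (1 + 3 * e)) * (T ^+ 2 / 2).
  rewrite mulr_ge0 ?divr_ge0 ?sqr_ge0 //.
  have : 0 <= (q - 1 / 2) ^+ 2 by rewrite sqr_ge0.
  move=> S; have : 0 <= e * (1 / 4 - q * (1 - q)) by rewrite mulr_ge0 //; lra.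
  lra.
lra.
Qed.

End NodeEstimates.

(** * Generic sliding orbits from sequences of offsets *)

Section SlidingData.
Variables (R : realType) (G : circular_polygon R).
Local Notation k := (narcs G).
Local Notation a := (angle G).
Local Notation r := (@radius R G).

(* Visit [i] to an arc consists of [impacts i] consecutive impacts with the same
   angle [incidence i]; [offset i] is the mid-angle, relative to the node, of the
   chord by which visit [i] begins. *)
Record sliding_data (arc : int -> 'I_k) := SlidingData {
  impacts : int -> nat;
  offset : int -> R;
  incidence : int -> R;
  impacts_gt0 : forall i, (0 < impacts i)%N;
  incidence_pi : forall i, 0 < incidence i < pi;
  impacts_incidence : forall i, 2 * (impacts i)%:R * incidence i =
    a (arc i).+1 - a (arc i) + offset (i + 1) - offset i;
  offset_start : forall i, - incidence i < offset i < incidence i;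
  offset_end : forall i, offset (i + 1) < incidence i;
  offset_neq0 : forall i, offset i <> 0;
  offset_crossing : forall i, crossing_eq (r (arc i)) (r (arc (i + 1)))
    (incidence i) (incidence (i + 1)) (offset (i + 1)) }.

Lemma ordS_neq (j : 'I_k) : ordS j <> j.
Proof.
move=> /(congr1 val) /=; have k1 := narcs_gt1 G; have jk := ltn_ord j.
move: jk; rewrite leq_eqVlt => /orP[/eqP jk|jk].
  by rewrite jk modnn => j0; rewrite -j0 in jk; rewrite -jk in k1.
by rewrite modn_small // => /eqP; rewrite eqn_leq ltnn.
Qed.

Variables (arc : int -> 'I_k).
Hypothesis arcS : forall i, arc (i + 1) = ordS (arc i).

Section Orbit.
Variable D : sliding_data arc.
Local Notation n := (impacts D).
Local Notation d := (offset D).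
Local Notation th := (incidence D).

(** The first impact of a visit is at angle [th] past the middle of the chord that opens it, and
    each further impact is [2 * th] later. *)
Definition impact (s : int * nat) : R * R :=
  (a (arc s.1) + d s.1 + th s.1 * (1 + 2 * s.2%:R), th s.1).

Definition next_state (s : int * nat) : int * nat :=
  if (s.2.+1 < n s.1)%N then (s.1, s.2.+1) else (s.1 + 1, 0%N).

Definition prev_state (s : int * nat) : int * nat :=
  if s.2 is m.+1 then (s.1, m) else (s.1 - 1, (n (s.1 - 1)).-1).

Definition state (N : int) : int * nat :=
  match N with
  | Posz m => iter m next_state (0, 0%N)
  | Negz m => iter m.+1 prev_state (0, 0%N)
  end.

Definition valid_state (s : int * nat) := (s.2 < n s.1)%N.

Lemma valid_next s : valid_state s -> valid_state (next_state s).
Proof.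
by rewrite /valid_state /next_state => sv; case: ifP => //= _; exact: impacts_gt0.
Qed.

Lemma valid_prev s : valid_state s -> valid_state (prev_state s).
Proof.
case: s => i [|m]; rewrite /valid_state /prev_state /=; last exact: ltnW.
by move=> _; rewrite ltn_predL impacts_gt0.
Qed.

Lemma prev_stateK s : valid_state s -> next_state (prev_state s) = s.
Proof.
case: s => i [|m]; rewrite /valid_state /next_state /prev_state /=; last by move=> ->.
by rewrite prednK ?impacts_gt0 // ltnn subrK.
Qed.

Lemma valid_state0 : valid_state (0, 0%N).
Proof. exact: impacts_gt0. Qed.

Lemma state_valid N : valid_state (state N).
Proof.
case: N => m; [elim: m => [|m IH]|elim: m => [|m IH]].
- exact: valid_state0.
- exact: valid_next.
- exact/valid_prev/valid_state0.
- exact: valid_prev.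
Qed.

Lemma stateS N : state (N + 1) = next_state (state N).
Proof.
case: N => [m|[|m]]; first by rewrite -PoszD addn1.
- by rewrite (_ : Negz 0 + 1 = 0) //= prev_stateK // valid_state0.
- rewrite (_ : Negz m.+1 + 1 = Negz m); last by rewrite !NegzE; lia.
  by rewrite [in RHS]/state iterS prev_stateK //; exact: (state_valid (Negz m)).
Qed.

(** By [impacts_incidence] the last impact is at [d (i + 1) - th i] from the end node, which is
    negative by [offset_end]. *)
Lemma impact_arc s : valid_state s ->
  a (arc s.1) < (impact s).1 < a (arc s.1).+1.
Proof.
case: s => i m; rewrite /valid_state /= => mn.
have /andP[th0 _] := incidence_pi D i.
have := impacts_incidence D i; have := offset_start D i; have := offset_end D i.
have m0 : 0 <= th i * m%:R by rewrite mulr_ge0 // ltW.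
have : th i * (m%:R + 1) <= th i * (n i)%:R by rewrite ler_pM2l // natr1 ler_nat.
lra.
Qed.

Lemma impact_arcW s : valid_state s ->
  a (arc s.1) <= (impact s).1 < a (arc s.1).+1.
Proof. by move=> /impact_arc /andP[/ltW -> ->]. Qed.

Lemma impact_interior s : valid_state s -> phase_interior G (impact s).
Proof.
move=> sv; split; first exact: arc_domain (impact_arcW sv).
exact: incidence_pi.
Qed.

Lemma impact_reflects s : valid_state s -> reflects G (impact s) (impact (next_state s)).
Proof.
move=> sv; have ns := impact_arcW (valid_next sv); have s_arc := impact_arcW sv.
move: ns; rewrite /next_state; case: ifP => [lt_n|ge_n] ns.
  have E : impact (s.1, s.2.+1) = ((impact s).1 + 2 * th s.1, th s.1).
    by rewrite /impact /= -natr1; congr pair; ring.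
  rewrite E; apply: (@reflects_same_arc _ G (arc s.1)) => //.
    exact: incidence_pi.
  by move: ns; rewrite E.
have En : s.2.+1 = n s.1 by apply/eqP; rewrite eqn_leq [X in _ && X]leqNgt ge_n andbT.
(* The last impact lies [th] before the middle of the chord that opens the next visit. *)
have Es : impact s = (a (arc s.1).+1 + d (s.1 + 1) - th s.1, th s.1).
  have := impacts_incidence D s.1; rewrite -En -natr1 /impact => H.
  by congr pair; lra.
have Et : impact (s.1 + 1, 0%N) =
    (a (ordS (arc s.1)) + d (s.1 + 1) + th (s.1 + 1), th (s.1 + 1)).
  by rewrite /impact /= mulr0 addr0 mulr1 arcS.
rewrite Et /= arcS in ns; rewrite Es /= in s_arc.
rewrite Es Et; apply: reflects_next_arc => //.
- exact: incidence_pi.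
- exact: incidence_pi.
- by move=> E; rewrite -E in ns; exact: ordS_neq (arc_uniq ns s_arc).
- by rewrite -arcS; exact: offset_crossing.
Qed.

Lemma billiard_iter_impact N : billiard_iter G N (impact (0, 0%N)) = impact (state N).
Proof.
case: N => m; elim: m => [|m IH] //.
- rewrite /= in IH *; rewrite IH; have sv := state_valid (Posz m).
  by apply: billiard_map_reflects (impact_interior sv) (impact_reflects sv).
- have sv := valid_state0; have pv := valid_prev sv.
  apply: (@billiard_inv_reflects _ _ _ _ (impact (next_state (0, 0%N)))).
  + exact: impact_interior.
  + by have := impact_reflects pv; rewrite prev_stateK.
  + exact: impact_reflects.
- have sv := state_valid (Negz m); have pv := valid_prev sv.
  rewrite (_ : billiard_iter G (Negz m.+1) (impact (0, 0%N)) =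
    billiard_inv G (billiard_iter G (Negz m) (impact (0, 0%N)))) // IH.
  apply: (@billiard_inv_reflects _ _ _ _ (impact (next_state (state (Negz m))))).
  + exact: impact_interior.
  + by have := impact_reflects pv; rewrite prev_stateK.
  + exact: impact_reflects.
Qed.

Lemma angle_domain (j : 'I_k) : a 0%N <= a j < a 0%N + 2 * pi.
Proof. by apply: (@arc_domain _ _ j); rewrite lexx angle_lt. Qed.

Lemma impact_not_node s (j : 'I_k) : valid_state s -> expi (impact s).1 <> expi (a j).
Proof.
move=> sv E; have H := expi_inj (arc_domain (impact_arcW sv)) (angle_domain j) E.
have Ej : arc s.1 = j.
  by apply: (arc_uniq (impact_arcW sv)); rewrite H lexx angle_lt.
by have := impact_arc sv; rewrite H Ej ltxx.
Qed.

(** The slopes lie at distance [th] or [2 * th] past a node, impact [m] at [d + th + 2 * th * m].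
    Equality fails for [m = 0] as [d] is neither 0 nor [th], and for [m > 0] as [d > - th]. *)
Lemma impact_not_slope s (j : 'I_k) (c : R) : valid_state s -> c = 1 / 2 \/ c = 1 ->
  ~ singular_slope j c (impact s).
Proof.
move=> sv c12 [_ E le_node]; have /andP[th0 thpi] := incidence_pi D s.1.
have c0 : 0 < c by case: c12 => ->; lra.
have tc0 : 0 < 2 * th s.1 * c by rewrite !mulr_gt0.
move: le_node; rewrite le_eqVlt => /orP[/eqP Ea|lt_node].
  by rewrite Ea expi_node in E; exact: impact_not_node sv E.
have tj : a j <= a j + 2 * (impact s).2 * c < a j.+1.
  by rewrite lt_node /= andbT lerDl; exact: ltW.
have H := expi_inj (arc_domain (impact_arcW sv)) (arc_domain tj) E.
have Ej : arc s.1 = j by apply: (arc_uniq (impact_arcW sv)); rewrite H.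
move: H; rewrite /impact Ej /= => H.
clear E; have ds := offset_start D s.1; have dn0 : d s.1 <> 0 by exact: offset_neq0.
have dE : d s.1 + th s.1 + 2 * (th s.1 * s.2%:R) = 2 * th s.1 * c by lra.
case: s.2 dE => [|m] dE.
  rewrite mulr0 mulr0 addr0 in dE; case: c12 => cE; rewrite cE in dE; last lra.
  by apply: dn0; lra.
have : th s.1 <= th s.1 * m.+1%:R by rewrite ler_peMr ?ler1n // ltW.
by case: c12 => cE; rewrite cE in dE; lra.
Qed.

Lemma impact_regular s : valid_state s -> ~ singularity_set G (impact s).
Proof.
move=> sv [j [[_ E]|E|E]]; first exact: impact_not_node sv E.
- by apply: impact_not_slope sv _ E; left.
- by apply: impact_not_slope sv _ E; right.
Qed.

Lemma impact_sliding : generic_sliding G (impact (0, 0%N)).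
Proof.
move=> N; rewrite !billiard_iter_impact; split; first exact/impact_regular/state_valid.
exists (arc (state N).1), (arc (state (N + 1)).1).
split; [exact/impact_arc/state_valid|exact/impact_arc/state_valid|].
by rewrite stateS /next_state; case: ifP => _ /=; [left|right].
Qed.

End Orbit.
End SlidingData.

(** * Speed of the orbits and recovery of the impact numbers *)

Section SlidingSpeed.
Variables (R : realType) (G : circular_polygon R).
Local Notation k := (narcs G).
Variables (arc : int -> 'I_k).
Hypothesis arcS : forall i, arc (i + 1) = ordS (arc i).

Section Counting.
Variable D : sliding_data arc.
Local Notation n := (impacts D).
Local Notation th := (incidence D).
Variables rho c1 C1 : R.
Hypothesis rho1 : 1 < rho.
Hypothesis c1_gt0 : 0 < c1.
Hypothesis C1_gt0 : 0 < C1.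
Hypothesis n_bounds : forall i : int,
  c1 * (rho ^+ `|i|.+1 - rho ^+ `|i|) <= (n i)%:R <= C1 * (rho ^+ `|i|.+1 - rho ^+ `|i|).

(** The bounds on the numbers of impacts telescope over the completed visits [0] to [p - 1]. *)
Let forward_count (m : nat) : exists p q,
  state D m = (Posz p, q) /\
  c1 * (rho ^+ p - 1) + q%:R <= m%:R <= C1 * (rho ^+ p - 1) + q%:R.
Proof.
elim: m => [|m [p [q [E H]]]].
  by exists 0%N, 0%N; split=> //; rewrite expr0 subrr !mulr0 addr0 lexx.
have -> : state D m.+1 = next_state D (state D m) by [].
have sv := state_valid D (Posz m).
rewrite E /valid_state /= in sv; rewrite E /next_state /=.
case: ifP => [lt_n|ge_n].
  by exists p, q.+1; split => //; rewrite -!natr1; lra.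
exists p.+1, 0%N; split; first by rewrite -PoszD addn1.
have En : q.+1 = n p by apply/eqP; rewrite eqn_leq [X in _ && X]leqNgt ge_n andbT.
have := n_bounds p; rewrite -En /= -!natr1 addr0; lra.
Qed.

(** Going back, the completed visits are [-1] to [- p], so the telescoping sum starts at [rho]
    instead of 1; [Negz p] is visit [- (p + 1)]. *)
Let backward_count (m : nat) : exists p q,
  [/\ state D (Negz m) = (Negz p, q),
   c1 * (rho ^+ p.+1 - rho) <= m.+1%:R + q%:R - (n (Negz p))%:R &
   m.+1%:R + q%:R <= C1 * (rho ^+ p.+2 - rho)].
Proof.
elim: m => [|m [p [q [E H1 H2]]]].
  exists 0%N, (n (Negz 0)).-1; split => //.
    by rewrite expr1 subrr mulr0 -natrD add1n prednK ?impacts_gt0 // subrr.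
  have := n_bounds (Negz 0); rewrite /= expr1 => /andP[_].
  by rewrite -natrD add1n prednK ?impacts_gt0.
have -> : state D (Negz m.+1) = prev_state D (state D (Negz m)) by [].
rewrite E /prev_state /=; case: q H1 H2 {E} => [|q] H1 H2; last first.
  by exists p, q; rewrite -!natr1 in H1 H2 *; split => //; lra.
exists p.+1, (n (Negz p.+1)).-1.
have Ep : Negz p - 1 = Negz p.+1 by rewrite !NegzE; lia.
rewrite Ep.
have En : (n (Negz p.+1)).-1%:R = (n (Negz p.+1))%:R - 1 :> R.
  by rewrite -[in RHS](prednK (impacts_gt0 D (Negz p.+1))) -natr1 addrK.
have B := n_bounds (Negz p); have B' := n_bounds (Negz p.+1).
rewrite /= in B B'; rewrite En.
have -> : m.+2%:R = m.+1%:R + 1 :> R by rewrite natr1.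
by split=> //; lra.
Qed.

Lemma state_count (N : int) :
  c1 * (rho ^+ `|(state D N).1| - rho) <= `|N|%N%:R <=
  C1 * rho ^+ `|(state D N).1|.+1.
Proof.
have rho0 : 0 < rho by apply: lt_trans rho1.
case: N => m.
  have [p [q [E H]]] := forward_count m.
  have sv := state_valid D (Posz m).
  rewrite E /valid_state /= in sv; rewrite E /=.
  have q0 : 0 <= q%:R :> R by [].
  have qn : q%:R <= (n p)%:R :> R by rewrite ler_nat ltnW.
  have := n_bounds p; rewrite /= => B.
  have : c1 * 1 <= c1 * rho by rewrite ler_pM2l // ltW.
  have := C1_gt0; lra.
have [p [q [E H1 H2]]] := backward_count m.
have sv := state_valid D (Negz m).
rewrite E /valid_state /= in sv; rewrite E /=.
have q0 : 0 <= q%:R :> R by [].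
have qn : q%:R <= (n (Negz p))%:R :> R by rewrite ler_nat ltnW.
have : 0 <= C1 * rho by rewrite mulr_ge0 // ltW.
lra.
Qed.

Variables k1 k2 : R.
Hypothesis k1_gt0 : 0 < k1.
Hypothesis th_bounds : forall i : int,
  k1 * rho ^+ `|i| <= 1 / th i <= k2 * rho ^+ `|i|.

(** Both the time and the inverse angle are comparable with [rho] to the power of the visit
    number. *)
Lemma impact_linear_speed :
  linear_speed G (k1 / (C1 * rho)) (k2 * (1 / c1 + rho)) (impact D (0, 0%N)).
Proof.
exists 1%N => N N1; rewrite (billiard_iter_impact arcS) /impact /=.
have := state_count N; have := th_bounds (state D N).1.
set x := 1 / _; set m := `|N|%N in N1 *; set y := rho ^+ _.
move=> /andP[L1 L2] /andP[N_lo N_hi].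
have rho0 : 0 < rho by apply: lt_trans rho1.
have y0 : 0 < y by rewrite exprn_gt0.
have m1 : 1 <= m%:R :> R by rewrite ler1n.
have k2_gt0 : 0 < k2.
  have : 0 < k2 * y by apply: lt_le_trans (le_trans L1 L2); rewrite mulr_gt0.
  by rewrite pmulr_lgt0.
apply/andP; split.
  apply: le_trans L1; rewrite mulrAC ler_pdivrMr ?mulr_gt0 // -mulrA ler_pM2l //.
  by move: N_hi; rewrite exprS -/y; lra.
apply: (le_trans L2); rewrite -mulrA ler_pM2l //.
have H : y <= m%:R / c1 + rho by rewrite -lerBlDr ler_pdivlMr // mulrC.
apply: (le_trans H); rewrite mulrDl mulrAC mul1r lerD2l.
by rewrite ler_peMr // ltW.
Qed.

End Counting.

Lemma linear_speed_asymptotic (c d : R) x : 0 < c ->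
  (forall N, 0 < (billiard_iter G N x).2) -> linear_speed G c d x -> asymptotic G x.
Proof.
move=> c0 pos [N0 H].
have bound (N : int) : (0 < `|N|)%N -> (N0 <= `|N|)%N ->
    `|(billiard_iter G N x).2| <= c^-1 * `|N|%N%:R^-1.
  move=> N1 NN; have /andP[+ _] := H N NN.
  have Np : 0 < `|N|%N%:R :> R by rewrite ltr0n.
  rewrite gtr0_norm ?pos // mul1r -invfM => le_inv.
  by rewrite -[X in X <= _]invrK lef_pV2 // posrE ?invr_gt0 ?mulr_gt0 ?pos.
have lim (s : nat -> int) : (forall n, `|s n| = n)%N ->
    (fun n => (billiard_iter G (s n) x).2) @ \oo --> (0 : R).
  move=> sn; have hc : (fun n : nat => c^-1 * n%:R^-1 : R) @ \oo --> (0 : R).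
    rewrite -(mulr0 c^-1); apply: cvgM; first exact: cvg_cst.
    rewrite -(cvg_shiftS _).
    exact: (@cvg_harmonic R).
  apply/cvgr0Pnorm_lt => e e0; move/cvgr0Pnorm_lt : hc => /(_ e e0) [N1 _ HN1].
  exists (maxn N0 (maxn 1 N1)) => // m /=; rewrite !geq_max => /and3P[m0 m1 m2].
  have := HN1 m m2; apply: le_lt_trans.
  apply: le_trans (ler_norm _).
  by have := bound (s m); rewrite sn; apply.
split; apply: lim => m //; first by rewrite abszN.
Qed.

Section Itinerary.
Variables D D' : sliding_data arc.
Hypothesis same_start : impact D (0, 0%N) = impact D' (0, 0%N).

Let same_impact N : impact D (state D N) = impact D' (state D' N).
Proof. by rewrite -!(billiard_iter_impact arcS) same_start. Qed.

(** Consecutive arcs differ, so the position of the next impact reveals whether the visit has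
    ended. *)
Let same_state (m : nat) : state D m = state D' m.
Proof.
elim: m => [//|m IH].
have := same_impact m.+1.
have E1 : state D m.+1 = next_state D (state D m) by [].
have E2 : state D' m.+1 = next_state D' (state D' m) by [].
have v1 := state_valid D m.+1; have v2 := state_valid D' m.+1.
have := impact_arcW v1; have := impact_arcW v2.
rewrite E1 E2 -IH /next_state; move: (state D m) => s.
case: ifP => c1; case: ifP => c2 // a2 a1 E.
- rewrite E in a1; have := arc_uniq a1 a2; rewrite /= arcS => H.
  by have := ordS_neq H.
- rewrite E in a1; have := arc_uniq a1 a2; rewrite /= arcS => /esym H.
  by have := ordS_neq H.
Qed.

Let state_reached (p q : nat) : (q < impacts D p)%N -> exists m : nat, state D m = (Posz p, q).
Proof.
elim: p q => [|p IHp]; elim=> [|q IHq] lt_q.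
- by exists 0%N.
- have [m E] := IHq (ltnW lt_q); exists m.+1.
  have -> : state D m.+1 = next_state D (state D m) by [].
  by rewrite E /next_state /= lt_q.
- have [|m E] := IHp (impacts D p).-1; first by rewrite ltn_predL impacts_gt0.
  exists m.+1; have -> : state D m.+1 = next_state D (state D m) by [].
  by rewrite E /next_state /= prednK ?impacts_gt0 // ltnn -PoszD addn1.
- have [m E] := IHq (ltnW lt_q); exists m.+1.
  have -> : state D m.+1 = next_state D (state D m) by [].
  by rewrite E /next_state /= lt_q.
Qed.

(** Different choices of impact numbers on the visits from 0 on thus give different starting
    points. *)
Lemma start_determines_impacts (p : nat) : impacts D p = impacts D' p.
Proof.
have [|m E] := @state_reached p (impacts D p).-1; first by rewrite ltn_predL impacts_gt0.
have E' : state D' m = (Posz p, (impacts D p).-1) by rewrite -same_state.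
have v' := state_valid D' m; rewrite E' /valid_state /= prednK ?impacts_gt0 // in v'.
have := same_state m.+1.
have -> : state D m.+1 = next_state D (state D m) by [].
have -> : state D' m.+1 = next_state D' (state D' m) by [].
rewrite E E' /next_state /= prednK ?impacts_gt0 // ltnn.
case: ifP => [_ /(congr1 snd)|ge_n _]; first by move=> /= n0; have := impacts_gt0 D p; rewrite -n0.
by apply/eqP; rewrite eqn_leq v' leqNgt ge_n.
Qed.

End Itinerary.

End SlidingSpeed.

(** * Solution of the crossing equations for prescribed impact numbers *)

Section Existence.
Variables (R : realType) (G : circular_polygon R).
Local Notation k := (narcs G).
Local Notation a := (angle G).
Local Notation r := (@radius R G).
Local Notation len j := (angle G (nat_of_ord j).+1 - angle G (nat_of_ord j)).
Local Notation quartic j := (Num.sqrt (Num.sqrt (r j))).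

Variables (arc : int -> 'I_k).
Hypothesis arcS : forall i, arc (i + 1) = ordS (arc i).
Variables (e t0 : R) (n : int -> nat).
Hypothesis e0 : 0 < e.
Hypothesis e88 : 88 * e <= 1.
Hypothesis e_gap : forall i j : 'I_k, r i < r j ->
  22 * e <= Num.sqrt (r i / r j) * (1 - Num.sqrt (r i / r j)).
Hypothesis t0_gt0 : 0 < t0.
Hypothesis t0_e : forall j, t0 <= quartic j * e.
Hypothesis t0_len : forall j, 5 * t0 <= quartic j * (e * len j).

(* The incidence angle aimed at during visit [i]: since the number of impacts of a
   visit is inversely proportional to it, geometric decay per visit is linear
   decay per impact. *)
Definition target (i : int) : R := t0 / quartic (arc i) / (1 + e) ^+ `|i|.

Hypothesis n_bounds : forall i,
  len (arc i) / (2 * target i) - 1 <= (n i)%:R <= len (arc i) / (2 * target i) + 1.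

Let rho1 : 1 <= 1 + e.
Proof. by rewrite lerDl ltW. Qed.

Let rho0 : 0 < 1 + e.
Proof. exact: lt_le_trans rho1. Qed.

Let quartic_gt0 j : 0 < quartic j.
Proof. by rewrite !sqrtr_gt0 radius_gt0. Qed.

Let quartic_sq j : quartic j ^+ 2 = Num.sqrt (r j).
Proof. by rewrite sqr_sqrtr // sqrtr_ge0. Qed.

Lemma target_gt0 i : 0 < target i.
Proof. by rewrite /target !divr_gt0 ?exprn_gt0. Qed.

Let target_le i : target i <= t0 / quartic (arc i).
Proof. by rewrite /target ler_pdivrMr ?exprn_gt0 // ler_peMr ?exprn_ege1 // ltW // divr_gt0. Qed.

Let target_e i : target i <= e.
Proof. by apply: le_trans (target_le i) _; rewrite ler_pdivrMr // mulrC. Qed.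

Let target_sq i : target i ^+ 2 <= e.
Proof.
have T0 := target_gt0 i; have := target_e i; have E0 := e0; have E88 := e88 => Te.
have : target i * target i <= target i * 1 by rewrite ler_pM2l //; lra.
by rewrite mulr1 expr2 => /le_trans; apply.
Qed.

Lemma target_len i : 5 * target i <= e * len (arc i).
Proof.
apply: le_trans (_ : 5 * (t0 / quartic (arc i)) <= _); first by rewrite ler_pM2l.
by rewrite mulrA ler_pdivrMr // mulrC mulrC [X in _ <= X]mulrC.
Qed.

(** The quartic root in [target] makes [q] the ratio of the squared targets, up to the factor
    [(1 + e) ^+ 2] between neighbouring visits. *)
Let pair_ratio i i' (q := Num.sqrt (r (arc i') / r (arc i))) :
  (`|i| <= `|i'|.+1)%N -> (`|i'| <= `|i|.+1)%N -> r (arc i') < r (arc i) ->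
  [/\ 0 < q < 1, q ^+ 2 * r (arc i) = r (arc i'),
      q * target i' ^+ 2 <= (1 + e) ^+ 2 * target i ^+ 2
    & target i ^+ 2 <= q * (1 + e) ^+ 2 * target i' ^+ 2].
Proof.
move=> ii' i'i rr; have r0 := radius_gt0 (arc i); have r0' := radius_gt0 (arc i').
have qE : q = Num.sqrt (r (arc i')) / Num.sqrt (r (arc i)).
  by rewrite /q sqrtrM ?sqrtrV // ltW.
have b0 : 0 < Num.sqrt (r (arc i)) by rewrite sqrtr_gt0.
have b0' : 0 < Num.sqrt (r (arc i')) by rewrite sqrtr_gt0.
have TE j : target j ^+ 2 = t0 ^+ 2 / Num.sqrt (r (arc j)) * ((1 + e) ^+ `|j|) ^- 2.
  by rewrite /target !exprMn !exprVn quartic_sq.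
have step (m m' : nat) : (m <= m'.+1)%N ->
    ((1 + e) ^+ m') ^- 2 <= (1 + e) ^+ 2 * ((1 + e) ^+ m) ^- 2.
  move=> mm'; rewrite ler_pdivlMr ?exprn_gt0 // mulrC ler_pdivrMr ?exprn_gt0 //.
  rewrite -!exprMn -exprS ler_pXn2r ?nnegrE ?exprn_ge0 ?(ltW rho0) //.
    by rewrite ler_weXn2l.
split.
- rewrite /q sqrtr_gt0 divr_gt0 //=.
  by rewrite -sqrtr1 ltr_sqrt // ltr_pdivrMr // mul1r.
- by rewrite /q sqr_sqrtr ?divrK ?unitf_gt0 // divr_ge0 // ltW.
- rewrite !TE qE.
  rewrite (_ : Num.sqrt (r (arc i')) / Num.sqrt (r (arc i)) *
      (t0 ^+ 2 / Num.sqrt (r (arc i')) * ((1 + e) ^+ `|i'|) ^- 2) =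
      t0 ^+ 2 / Num.sqrt (r (arc i)) * ((1 + e) ^+ `|i'|) ^- 2).
    by rewrite [X in _ <= X]mulrCA ler_pM2l ?step // divr_gt0 // exprn_gt0.
  by field; rewrite !gt_eqF //= exprn_gt0.
- rewrite !TE qE.
  rewrite (_ : Num.sqrt (r (arc i')) / Num.sqrt (r (arc i)) * (1 + e) ^+ 2 *
      (t0 ^+ 2 / Num.sqrt (r (arc i')) * ((1 + e) ^+ `|i'|) ^- 2) = t0 ^+ 2 / Num.sqrt (r (arc i)) *
     ((1 + e) ^+ 2 * ((1 + e) ^+ `|i'|) ^- 2)).
    by rewrite ler_pM2l ?step // divr_gt0 // exprn_gt0.
  by field; rewrite !gt_eqF //= exprn_gt0.
Qed.

Let near_target (i : int) (t : R) := (1 - e) * target i <= t <= (1 + e) * target i.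

Let pair_order i i' :
  (`|i| <= `|i'|.+1)%N -> (`|i'| <= `|i|.+1)%N -> r (arc i') < r (arc i) ->
  target i <= target i'.
Proof.
move=> ii' i'i rr; have [q1 q2 q3 q4] := pair_ratio ii' i'i rr.
exact: (node_order q1 e0 (e_gap rr) (target_gt0 i) (target_gt0 i') q4).
Qed.

Let pair_outer i i' t t' :
  (`|i| <= `|i'|.+1)%N -> (`|i'| <= `|i|.+1)%N -> r (arc i') < r (arc i) ->
  near_target i t -> near_target i' t' ->
  r (arc i') * (1 - cos t') + (r (arc i) - r (arc i')) * (1 - cos (2 * e * target i)) <=
  r (arc i) * (1 - cos t).
Proof.
move=> ii' i'i rr ti ti'; have [q1 q2 q3 q4] := pair_ratio ii' i'i rr.
have := node_outer q1 e0 (e_gap rr) (target_gt0 i) (target_gt0 i') q3 ti ti' (target_sq i).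
rewrite -(ler_pM2l (radius_gt0 (arc i))).
by move: (Num.sqrt (_ / _)) q2 {q1 q3 q4} => q <-; lra.
Qed.

Let pair_inner i i' t t' :
  (`|i| <= `|i'|.+1)%N -> (`|i'| <= `|i|.+1)%N -> r (arc i') < r (arc i) ->
  near_target i t -> near_target i' t' ->
  r (arc i) * (1 - cos t) <= r (arc i') * (1 - cos t') +
  (r (arc i) - r (arc i')) * (1 - cos ((1 - 2 * e) * target i)).
Proof.
move=> ii' i'i rr ti ti'; have [q1 q2 q3 q4] := pair_ratio ii' i'i rr.
have := node_inner q1 e0 (e_gap rr) (target_gt0 i) (target_gt0 i') q4 ti ti'
  (target_sq i) (target_sq i').
rewrite -(ler_pM2l (radius_gt0 (arc i))).
by move: (Num.sqrt (_ / _)) q2 {q1 q3 q4} => q <-; lra.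
Qed.

Let opening (i : int) := r (arc (i - 1)) < r (arc i).

(** The middle of a crossing chord is sought on the side of the larger circle, in units of the
    target there. [pair_outer] and [pair_inner] give opposite signs at the two ends of this
    interval. *)
Let lo (i : int) : R :=
  if opening i then 2 * e * target i else - ((1 - 2 * e) * target (i - 1)).

Let hi (i : int) : R :=
  if opening i then (1 - 2 * e) * target i else - (2 * e * target (i - 1)).

Let inbox (d : int -> R) := forall i, lo i <= d i <= hi i.

Let theta (d : int -> R) i : R := (len (arc i) + d (i + 1) - d i) / (2 * (n i)%:R).

(** Equal radii would make the curve C2 at the node. *)
Let closing i : ~~ opening i -> r (arc i) < r (arc (i - 1)).
Proof.
rewrite /opening -leNgt le_eqVlt => /orP[/eqP E|//]; exfalso.
apply: (@node_notC2 _ G (arc (i - 1))).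
by rewrite -arcS subrK /arc_curvature E expi_node -arcS subrK.
Qed.

Let dist1 i : (`|i| <= `|i - 1|.+1)%N /\ (`|i - 1| <= `|i|.+1)%N.
Proof. lia. Qed.

(** The larger circle has the smaller target, so a bound in its units holds for both neighbours. *)
Let offset_bound d i : inbox d ->
  [/\ 0 < `|d i|, `|d i| <= (1 - 2 * e) * target i &
      `|d i| <= (1 - 2 * e) * target (i - 1)].
Proof.
move=> /(_ i); rewrite /lo /hi; have [D1 D2] := dist1 i.
have E0 := e0; have E88 := e88.
have T0 := target_gt0 i; have T0' := target_gt0 (i - 1).
have eT : 0 < e * target i by rewrite mulr_gt0.
have eT' : 0 < e * target (i - 1) by rewrite mulr_gt0.
have p2 : 0 <= 1 - 2 * e by lra.
case: ifPn => [op|/closing cl] /andP[d_lo d_hi].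
  have := ler_wpM2l p2 (pair_order D1 D2 op) => H.
  by rewrite gtr0_norm; [split|]; lra.
have := ler_wpM2l p2 (pair_order D2 D1 cl) => H.
by rewrite ltr0_norm; [split|]; lra.
Qed.

Let impacts_range i :
  len (arc i) - 2 * target i <= 2 * target i * (n i)%:R <= len (arc i) + 2 * target i.
Proof.
have T0 := target_gt0 i; have /andP[n1 n2] := n_bounds i.
have T2 : 0 < 2 * target i by rewrite mulr_gt0.
have E : len (arc i) / (2 * target i) * (2 * target i) = len (arc i).
  by rewrite divfK // gt_eqF.
move: (_ / _) n1 n2 E => X n1 n2 E.
rewrite -(ler_pM2r T2) mulrBl E mul1r in n1.
have := ler_wpM2r (ltW T2) n1; have := ler_wpM2r (ltW T2) n2; lra.
Qed.

Lemma impacts_pos i : 0 < (n i)%:R :> R.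
Proof.
have T0 := target_gt0 i; have /andP[n1 _] := impacts_range i.
have := target_len i; have L := arc_length_gt0 (arc i); have E88 := e88 => Tl.
have eL : e * len (arc i) <= 1 * len (arc i) by rewrite ler_wpM2r ?ltW //; lra.
have T2 : 0 < 2 * target i by rewrite mulr_gt0.
by rewrite -(pmulr_rgt0 _ T2); lra.
Qed.

(** Rounding the number of impacts and moving the two offsets each cost at most [2 * target i], and
    [target_len] makes the sum small against [e * len]. *)
Let theta_near d i : inbox d -> near_target i (theta d i).
Proof.
move=> db; have [_ + _] := offset_bound i db; have [_ _ +] := offset_bound (i + 1) db.
rewrite addrK !ler_norml => b2 b1.
have T0 := target_gt0 i; have /andP[n1 n2] := impacts_range i.
have := target_len i; have L := arc_length_gt0 (arc i); have E0 := e0; have E88 := e88 => Tl.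
have eT : 0 < e * target i by rewrite mulr_gt0.
have eTT : e * target i <= 1 / 2 * target i by rewrite ler_pM2r //; lra.
have N2 : 0 < 2 * (n i)%:R :> R by rewrite mulr_gt0 ?impacts_pos.
have n2' : (1 - e) * (2 * target i * (n i)%:R) <= (1 - e) * (len (arc i) + 2 * target i).
  by rewrite ler_wpM2l //; lra.
have n1' : (1 + e) * (len (arc i) - 2 * target i) <= (1 + e) * (2 * target i * (n i)%:R).
  by rewrite ler_wpM2l //; lra.
rewrite /near_target /theta ler_pdivlMr // ler_pdivrMr //.
by apply/andP; split; lra.
Qed.

Let near_pi i t : near_target i t -> 0 < t < pi.
Proof.
have T0 := target_gt0 i; have E0 := e0; have E88 := e88; have Te := target_e i.
rewrite /near_target => /andP[t1 t2]; have pi2 := pi_ge2 R.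
have : 0 < (1 - e) * target i by rewrite mulr_gt0 //; lra.
have : (1 + e) * target i <= 2 * e by apply: ler_pM => //; lra.
lra.
Qed.

(** The crossing equation at the node that opens visit [i], with the incidence angles expressed by
    three consecutive offsets. *)
Let crossing_defect (i : int) (p x y : R) : R :=
  r (arc i) * (1 - cos ((len (arc i) + y - x) / (2 * (n i)%:R)))
  - r (arc (i - 1)) * (1 - cos ((len (arc (i - 1)) + x - p) / (2 * (n (i - 1))%:R)))
  - (r (arc i) - r (arc (i - 1))) * (1 - cos x).

Let defectE d i : crossing_defect i (d (i - 1)) (d i) (d (i + 1)) =
  r (arc i) * (1 - cos (theta d i)) - r (arc (i - 1)) * (1 - cos (theta d (i - 1)))
  - (r (arc i) - r (arc (i - 1))) * (1 - cos (d i)).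
Proof. by rewrite /crossing_defect /theta subrK. Qed.

Let lo_le_hi i : lo i <= hi i.
Proof.
have T0 := target_gt0 i; have T0' := target_gt0 (i - 1); have E0 := e0; have E88 := e88.
have H : 2 * e <= 1 - 2 * e by lra.
by rewrite /lo /hi; case: ifP => _; rewrite ?lerN2 ler_pM2r.
Qed.

Let lo_in : inbox lo. Proof. by move=> i; rewrite lexx lo_le_hi. Qed.
Let hi_in : inbox hi. Proof. by move=> i; rewrite lexx lo_le_hi. Qed.

Let defect_lo i : 0 <= crossing_defect i (lo (i - 1)) (lo i) (lo (i + 1)).
Proof.
rewrite defectE; have N := theta_near i lo_in; have N' := theta_near (i - 1) lo_in.
have [D1 D2] := dist1 i.
rewrite {3}/lo; case: ifPn => [op|/closing cl].
  by have := pair_outer D1 D2 op N N'; lra.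
by rewrite cosN; have := pair_inner D2 D1 cl N' N; lra.
Qed.

Let defect_hi i : crossing_defect i (hi (i - 1)) (hi i) (hi (i + 1)) <= 0.
Proof.
rewrite defectE; have N := theta_near i hi_in; have N' := theta_near (i - 1) hi_in.
have [D1 D2] := dist1 i.
rewrite {3}/hi; case: ifPn => [op|/closing cl].
  by have := pair_inner D1 D2 op N N'; lra.
by rewrite cosN; have := pair_outer D2 D1 cl N' N; lra.
Qed.

Let cos_anti (s t : R) : 0 < s < pi -> 0 < t < pi -> s <= t -> cos t <= cos s.
Proof.
move=> s0 t0' st; apply: cos_le_norm; rewrite !gtr0_norm //; lra.
Qed.

(** A larger offset [i + 1] raises the angle of visit [i], a larger offset [i - 1] lowers that of
    visit [i - 1], and both raise the defect. The box keeps the angles in the range where the cosine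
    decreases. *)
Let defect_mono (d d' : int -> R) i : inbox d -> inbox d' ->
  (forall j, d j <= d' j) -> d i = d' i ->
  crossing_defect i (d (i - 1)) (d i) (d (i + 1)) <=
  crossing_defect i (d' (i - 1)) (d' i) (d' (i + 1)).
Proof.
move=> db db' dd' di; rewrite !defectE di.
have H1 : cos (theta d' i) <= cos (theta d i).
  apply: cos_anti; [exact: near_pi (theta_near i db)|exact: near_pi (theta_near i db')|].
  by rewrite /theta ler_pM2r ?invr_gt0 ?mulr_gt0 ?impacts_pos // di lerB // lerD.
have H2 : cos (theta d (i - 1)) <= cos (theta d' (i - 1)).
  apply: cos_anti; [exact: near_pi (theta_near _ db')|exact: near_pi (theta_near _ db)|].
  by rewrite /theta subrK di ler_pM2r ?invr_gt0 ?mulr_gt0 ?impacts_pos // lerB.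
have := radius_gt0 (arc i); have := radius_gt0 (arc (i - 1)) => r1 r2.
rewrite -(ler_pM2l r2) in H1; rewrite -(ler_pM2l r1) in H2; lra.
Qed.

Let defect_cont i p y : continuous (fun x => crossing_defect i p x y).
Proof.
move=> x; rewrite /crossing_defect.
have lin (u v w : R) : {for x, continuous (fun x => (u + v * x) / w)}.
  by apply: cvgM; [apply: cvgD; [exact: cvg_cst|apply: cvgM; [exact: cvg_cst|exact: cvg_id]]
    |exact: cvg_cst].
have cosl (u v w : R) (f : R -> R) : (forall t, f t = (u + v * t) / w) ->
    cos (f t) @[t --> x] --> cos (f x).
  move=> fE; have -> : f = (fun t => (u + v * t) / w) by apply/funext.
  by apply: continuous_comp (lin u v w) _; exact: continuous_cos.
apply: cvgB; [apply: cvgB|]; apply: cvgM; (try exact: cvg_cst);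
  apply: cvgB; (try exact: cvg_cst).
- by apply: (cosl (len (arc i) + y) (- 1) (2 * (n i)%:R)) => t; rewrite mulN1r.
- by apply: (cosl (len (arc (i - 1)) - p) 1 (2 * (n (i - 1))%:R)) => t; rewrite mul1r addrAC.
- exact: continuous_cos.
Qed.

Lemma sliding_data_exists : exists D : sliding_data arc,
  (forall i, impacts D i = n i) /\
  (forall i, (1 - e) * target i <= incidence D i <= (1 + e) * target i).
Proof.
have [d [db dE]] : exists d : int -> R, inbox d /\
    forall i, crossing_defect i (d (i - 1)) (d i) (d (i + 1)) = 0.
  apply: (@monotone_zero R int (fun i => i - 1) (fun i => i + 1)) => //.
  - by move=> i; lia.
  - by move=> i; lia.
have N_gt0 i : (0 < n i)%N by rewrite -(ltr0n R) impacts_pos.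
have th_pi i : 0 < theta d i < pi by apply: (near_pi (i := i)); exact: theta_near.
have thE i : 2 * (n i)%:R * theta d i = a (arc i).+1 - a (arc i) + d (i + 1) - d i.
  by rewrite mulrC /theta divfK // gt_eqF // mulr_gt0 // impacts_pos.
(* Offsets are at most [1 - 2 * e] targets and angles at least [1 - e] targets, hence the strict
   inequalities of [sliding_data]. *)
have gap i : (1 - 2 * e) * target i < theta d i.
  have /andP[H _] := theta_near i db; apply: lt_le_trans H.
  by rewrite ltr_pM2r ?target_gt0 //; have := e0; lra.
have start i : - theta d i < d i < theta d i.
  have [_ H _] := offset_bound i db.
  by rewrite -ltr_norml (le_lt_trans H).
have stop i : d (i + 1) < theta d i.
  have [_ _ H] := offset_bound (i + 1) db; rewrite addrK in H.
  by apply: le_lt_trans (ler_norm _) (le_lt_trans H _).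
have neq0 i : d i <> 0.
  by have [H _ _] := offset_bound i db => di; rewrite di normr0 ltxx in H.
have cross i : crossing_eq (r (arc i)) (r (arc (i + 1))) (theta d i) (theta d (i + 1)) (d (i + 1)).
  by have := dE (i + 1); rewrite defectE addrK /crossing_eq; lra.
exists (SlidingData N_gt0 th_pi thE start stop neq0 cross); split => // i.
exact: theta_near.
Qed.

End Existence.

(** * A family of trajectories indexed by binary sequences *)

Section Family.
Variables (R : realType) (G : circular_polygon R).
Local Notation k := (narcs G).
Local Notation a := (angle G).
Local Notation r := (@radius R G).
Local Notation len j := (angle G (nat_of_ord j).+1 - angle G j).
Local Notation quartic j := (Num.sqrt (Num.sqrt (r j))).

Lemma arc_sequence : exists arc : int -> 'I_k, forall i, arc (i + 1) = ordS (arc i).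
Proof.
pose j0 := Ordinal (narcs_gt0 G).
exists (fun i => match i with
  | Posz m => iter m (@ordS k) j0
  | Negz m => iter m.+1 (@ord_pred k) j0
  end).
case=> [m|[|m]].
- by rewrite -PoszD addn1.
- by rewrite (_ : Negz 0 + 1 = 0) //= ord_predK.
- rewrite (_ : Negz m.+1 + 1 = Negz m); last by rewrite !NegzE; lia.
  by rewrite [in RHS]iterS ord_predK.
Qed.

Lemma quartic_gt0 (j : 'I_k) : 0 < quartic j.
Proof. by rewrite !sqrtr_gt0 radius_gt0. Qed.

Lemma sliding_family : exists c d : R, 0 < c < d /\
  exists x : (nat -> bool) -> R * R, injective x /\
  forall w, [/\ phase_interior G (x w), generic_sliding G (x w),
    asymptotic G (x w) & linear_speed G c d (x w)].
Proof.
have [arc arcS] := arc_sequence.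
have [|e1 /andP[e1_0 e1_1] e1_gap] := @finite_lower_bound R _
  (fun ij : 'I_k * 'I_k => r ij.1 < r ij.2)
  (fun ij => Num.sqrt (r ij.1 / r ij.2) * (1 - Num.sqrt (r ij.1 / r ij.2))).
  move=> [i j] /= rij; have rj := radius_gt0 j.
  rewrite mulr_gt0 ?sqrtr_gt0 ?divr_gt0 ?radius_gt0 // subr_gt0.
  by rewrite -sqrtr1 ltr_sqrt // ltr_pdivrMr // mul1r.
(* Since [e1 <= 1], this meets both [88 * e <= 1] and the gap condition. *)
pose e := e1 / 88.
have e0 : 0 < e by rewrite divr_gt0.
have e88 : 88 * e <= 1 by rewrite /e; lra.
have e_gap (i j : 'I_k) : r i < r j ->
    22 * e <= Num.sqrt (r i / r j) * (1 - Num.sqrt (r i / r j)).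
  by move=> /(e1_gap (i, j)) /=; apply: le_trans; rewrite /e; lra.
have qpos (j : 'I_k) : 0 < quartic j := quartic_gt0 j.
have lpos (j : 'I_k) : 0 < len j := arc_length_gt0 j.
have [t1 /andP[t1_0 _] t1_le] := @finite_lower_bound R _ predT
  (fun j : 'I_k => quartic j * e) (fun j _ => mulr_gt0 (qpos j) e0).
have [t2 /andP[t2_0 _] t2_le] := @finite_lower_bound R _ predT
  (fun j : 'I_k => quartic j * (e * len j)) (fun j _ => mulr_gt0 (qpos j) (mulr_gt0 e0 (lpos j))).
pose t0 := Num.min t1 (t2 / 5).
have t0_gt0 : 0 < t0 by rewrite lt_min t1_0 divr_gt0.
have t0_e (j : 'I_k) : t0 <= quartic j * e.
  by apply: le_trans (t1_le j isT); rewrite /t0 ge_min lexx.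
have t0_len (j : 'I_k) : 5 * t0 <= quartic j * (e * len j).
  apply: le_trans (t2_le j isT); rewrite mulrC -ler_pdivlMr //.
  by rewrite /t0 ge_min lexx orbT.
pose T := target arc e t0.
have T0 i : 0 < T i by exact: target_gt0.
(* Truncation loses less than 1, so adding the bit 0 or 1 stays within 1 of the ideal number. *)
pose n (w : nat -> bool) (i : int) := (Num.truncn (len (arc i) / (2 * T i)) + w `|i|%N)%N.
have n_bounds w i : len (arc i) / (2 * T i) - 1 <= (n w i)%:R <= len (arc i) / (2 * T i) + 1.
  have X0 : 0 <= len (arc i) / (2 * T i) := ltW (divr_gt0 (lpos _) (mulr_gt0 (ltr0Sn _ 1) (T0 i))).
  have /andP[] := Num.Theory.truncn_itv X0.
  have : 0 <= (w `|i|%N)%:R :> R by [].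
  have : (w `|i|%N)%:R <= 1 :> R by rewrite lern1 leq_b1.
  rewrite /n natrD -natr1; lra.
have D_ex w := sliding_data_exists arcS e0 e88 e_gap t0_gt0 t0_e t0_len (n_bounds w).
pose D w := projT1 (cid (D_ex w)).
have Dn w i : impacts (D w) i = n w i by rewrite /D; case: cid => ? [].
have Dth w i : (1 - e) * T i <= incidence (D w) i <= (1 + e) * T i.
  by rewrite /D; case: cid => ? [].
pose x w := impact (D w) (0, 0%N).
have x_inj : injective x.
  move=> w w' xw; apply/funext => p.
  have := start_determines_impacts arcS xw p; rewrite !Dn /n => /eqP.
  by rewrite eqn_add2l /=; case: (w p); case: (w' p).
have [c1 /andP[c1_0 _] c1_le] := @finite_lower_bound R _ predT
  (fun j : 'I_k => len j * quartic j / (4 * t0 * e))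
  (fun j _ => divr_gt0 (mulr_gt0 (lpos j) (qpos j)) (mulr_gt0 (mulr_gt0 (ltr0Sn _ 3) t0_gt0) e0)).
(* Upper constants are obtained as inverses of lower bounds, here [m1^-1] and below [m2^-1]. *)
have [m1 /andP[m1_0 _] m1_le] := @finite_lower_bound R _ predT
  (fun j : 'I_k => (t0 * e) / (len j * quartic j))
  (fun j _ => divr_gt0 (mulr_gt0 t0_gt0 e0) (mulr_gt0 (lpos j) (qpos j))).
have e1p : 0 < 1 + e by lra.
have e1m : 0 < 1 - e by lra.
have [k1 /andP[k1_0 _] k1_le] := @finite_lower_bound R _ predT
  (fun j : 'I_k => quartic j / ((1 + e) * t0))
  (fun j _ => divr_gt0 (qpos j) (mulr_gt0 e1p t0_gt0)).
have [m2 /andP[m2_0 _] m2_le] := @finite_lower_bound R _ predT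
  (fun j : 'I_k => (1 - e) * t0 / quartic j)
  (fun j _ => divr_gt0 (mulr_gt0 e1m t0_gt0) (qpos j)).
have TE i : T i = t0 / quartic (arc i) / (1 + e) ^+ `|i| by [].
have speed w : linear_speed G (k1 / (m1^-1 * (1 + e))) (m2^-1 * (1 / c1 + (1 + e))) (x w).
  apply: impact_linear_speed => //; [lra|by rewrite invr_gt0| |].
  - move=> i; rewrite Dn; set y := (1 + e) ^+ `|i|%N.
    have y0 : 0 < y by rewrite exprn_gt0.
    have -> : (1 + e) ^+ `|i|%N.+1 - y = e * y by rewrite exprS -/y; ring.
    have X : len (arc i) / (2 * T i) = len (arc i) * quartic (arc i) * y / (2 * t0).
      by rewrite TE -/y; field; rewrite !gt_eqF.
    (* For a quotient [X >= 2], the rounding error is absorbed by [X / 2 <= X - 1] and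
       [X + 1 <= 2 * X]. *)
    have X5 : 2 <= len (arc i) / (2 * T i).
      rewrite (ler_pdivlMr _ _ (mulr_gt0 (ltr0Sn _ 1) (T0 i))).
      have Ti := T0 i; have H : 5 * T i <= e * len (arc i) by exact: target_len.
      have : e * len (arc i) <= 1 * len (arc i) by rewrite ler_pM2r //; lra.
      lra.
    have L1 : c1 * (e * y) <= len (arc i) / (2 * T i) / 2.
      rewrite X; apply: le_trans (_ : len (arc i) * quartic (arc i) / (4 * t0 * e) * (e * y) <= _).
        by rewrite ler_pM2r ?mulr_gt0 // c1_le.
      by rewrite le_eqVlt; apply/orP; left; apply/eqP; field; rewrite !gt_eqF.
    have L2 : 2 * (len (arc i) / (2 * T i)) <= m1^-1 * (e * y).
      rewrite X ler_pdivlMl //.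
      apply: le_trans (_ : t0 * e / (len (arc i) * quartic (arc i)) *
        (2 * (len (arc i) * quartic (arc i) * y / (2 * t0))) <= _).
        by rewrite ler_wpM2r ?m1_le // !mulr_ge0 ?invr_ge0 ?mulr_ge0 // ltW.
      by rewrite le_eqVlt; apply/orP; left; apply/eqP; field; rewrite !gt_eqF.
    have := n_bounds w i; lra.
  - move=> i; set y := (1 + e) ^+ `|i|%N.
    have y0 : 0 < y by rewrite exprn_gt0.
    have /andP[th1 th2] := Dth w i.
    have th0 : 0 < incidence (D w) i by apply: lt_le_trans th1; rewrite mulr_gt0.
    apply/andP; split.
      rewrite ler_pdivlMr //; apply: le_trans (_ : k1 * y * ((1 + e) * T i) <= _).
        by rewrite ler_pM2l // mulr_gt0.
      have -> : k1 * y * ((1 + e) * T i) = k1 * ((1 + e) * t0 / quartic (arc i)).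
        by rewrite TE -/y; field; rewrite !gt_eqF.
      rewrite -ler_pdivlMr ?mulr_gt0 ?invr_gt0 ?mulr_gt0 // mul1r invf_div.
      exact: k1_le.
    rewrite ler_pdivrMr //; apply: le_trans (_ : m2^-1 * y * ((1 - e) * T i) <= _); last first.
      by rewrite ler_pM2l // mulr_gt0 // invr_gt0.
    have -> : m2^-1 * y * ((1 - e) * T i) = m2^-1 * ((1 - e) * t0 / quartic (arc i)).
      by rewrite TE -/y; field; rewrite !gt_eqF.
    by rewrite ler_pdivlMl // mulr1 m2_le.
set c := k1 / _ in speed; set d := _ * _ in speed.
have c0 : 0 < c by rewrite divr_gt0 // mulr_gt0 // invr_gt0.
have d0 : 0 < d by rewrite mulr_gt0 ?invr_gt0 // addr_gt0 // divr_gt0.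
(* The sum ensures that the upper constant exceeds the lower one. *)
exists c, (c + d); split; first by rewrite c0 ltrDl.
exists x; split => // w.
have pos N : 0 < (billiard_iter G N (x w)).2.
  rewrite /x (billiard_iter_impact arcS) /=.
  by case/andP: (incidence_pi (D w) (state (D w) N).1).
split.
- exact/impact_interior/valid_state0.
- exact: impact_sliding.
- exact: linear_speed_asymptotic c0 pos (speed w).
- have [N0 H] := speed w; exists N0 => N /H /andP[-> H2] /=.
  by apply: (le_trans H2); rewrite ler_wpM2r // lerDr ltW.
Qed.

Lemma trajectory_countable x : countable (trajectory G x).
Proof. by apply: sub_countable (card_image_le _ _) _. Qed.

End Family.

(** * Uncountability and conclusion *)

(** Cantor's diagonal argument: [w] differs at [n] from every sequence that [f] sends to [n]. *)
Lemma no_injection_nat_bool_nat (f : (nat -> bool) -> nat) : ~ injective f.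
Proof.
move=> f_inj; pose w n := ~~ `[< exists w', f w' = n /\ w' n >].
have := erefl (w (f w)); rewrite {1}/w.
case: asboolP => /= [[w' [/f_inj -> ->]] //|H wf].
by apply: H; exists w.
Qed.

Local Close Scope complex_scope.

Theorem theorem3 (R : realType) (G : circular_polygon R) :
  (exists c d : R, 0 < c < d /\
     ~ countable [set trajectory G x | x in
         [set x | [/\ phase_interior G x, generic_sliding G x,
                      asymptotic G x & linear_speed G c d x]]]) /\
  ~ (exists x : R * R, phase_interior G x /\
       (fun n : nat => n%:R * (billiard_iter G (n%:Z) x).2) @ \oo --> (0 : R)).
Proof.
split; last by move=> [x [xI]]; exact: not_faster_than_linear.
have [c [d [cd [x [x_inj xS]]]]] := sliding_family G.
exists c, d; split=> //; set S := [set y | _] => ctb.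
(* Each trajectory is countable, so countably many of them would contain only countably many of the
   starting points [x w]. *)
have : countable (\bigcup_(t in [set trajectory G y | y in S]) t).
  by apply: bigcup_countable => // _ [y _ <-]; exact: trajectory_countable.
move=> /countable_injP[f f_inj]; apply: (@no_injection_nat_bool_nat (f \o x)) => w w' /= fw.
have inU v : x v \in \bigcup_(t in [set trajectory G y | y in S]) t.
  by rewrite inE; exists (trajectory G (x v)); [exists (x v) => //; exact: xS|exists (0 : int)].
by apply: x_inj; apply: f_inj.
Qed.
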